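(* Let $\epsilon>0$ and let $(x(t),y(t))$, $-\epsilon<t<\epsilon$, be a minimal time path in $\mathbb{R}^2$ whose acceleration $(x'',y'')$ is continuous, of unit magnitude, and not constant on $(-\epsilon,\epsilon)$. Then there exist unique values $\alpha>0$, $\theta\in(-\pi/2,\pi/2)$, $\sigma,\eta\in\{1,-1\}$ and $t_0\in\mathbb{R}$ such that, for some $u_0,v_0\in\mathbb{R}$ and some constant vector $c\in\mathbb{R}^2$, $$\begin{pmatrix} x(t)\\ y(t)\end{pmatrix}= c+\frac{1}{\alpha^2}\begin{pmatrix}\cos\theta&-\sin\theta\\ \sin\theta&\cos\theta\end{pmatrix}\begin{pmatrix}\sigma&0\\0&\eta\end{pmatrix}\begin{pmatrix} f(\alpha(t-t_0))+u_0\,\alpha(t-t_0)\\ g(\alpha(t-t_0))+v_0\,\alpha(t-t_0)\end{pmatrix}$$ for all $-\epsilon<t<\epsilon$.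
   Context: The functions $f,g:\mathbb{R}\to\mathbb{R}$ are $f(t)=t\,\mathrm{arcsinh}(t)-\sqrt{1+t^2}$ and $g(t)=\frac12\left(t\sqrt{1+t^2}+\mathrm{arcsinh}(t)\right)$, so that $f'(t)=\mathrm{arcsinh}(t)$, $g'(t)=\sqrt{1+t^2}$, $f''(t)=1/\sqrt{1+t^2}$, $g''(t)=t/\sqrt{1+t^2}$. Admissible trajectories are planar curves with bounded acceleration $|(x'',y'')|\le 1$ (velocity Lipschitz, with the bound holding almost everywhere). A path on $(-\epsilon,\epsilon)$ is a minimal time path if for every closed subinterval $[a,b]\subset(-\epsilon,\epsilon)$ no admissible trajectory takes less time than $b-a$ to go from the position and velocity of the path at time $a$ to its position and velocity at time $b$.
   Formalization: The range of θ is (-π/2, π/2] instead of (-π/2, π/2): with the open interval existence fails, e.g. for the minimal time path x = g(t) - t, y = f(t) on (-1, 1), whose acceleration (t,1)/√(1+t²) needs cos θ = 0. *)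

(* Defs.v *)
From HB Require Import structures.
From mathcomp Require Export all_boot all_order all_algebra.
From mathcomp Require Export all_classical all_reals all_analysis.
Export Order.TTheory GRing.Theory Num.Theory.
Export numFieldNormedType.Exports.

Set Implicit Arguments.
Unset Strict Implicit.
Unset Printing Implicit Defensive.

Local Open Scope classical_set_scope.
Local Open Scope ring_scope.

Definition arcsinh (R : realType) (t : R) : R :=
  ln (t + Num.sqrt (1 + t ^+ 2)).

Definition profile_f (R : realType) (t : R) : R :=
  t * arcsinh t - Num.sqrt (1 + t ^+ 2).

Definition profile_g (R : realType) (t : R) : R :=
  2^-1 * (t * Num.sqrt (1 + t ^+ 2) + arcsinh t).

(* The library norms on R * R and 'cV[R]_2 are sup norms; the acceleration is
   measured in the Euclidean one. *)
Definition enorm (R : realType) (a b : R) : R := Num.sqrt (a ^+ 2 + b ^+ 2).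

(* (x, y) is an admissible trajectory on [a, b] with velocity (u, v).
   The velocity is an explicit argument, so that it is meaningful at a and b,
   where the two-sided derivatives of x and y say nothing about the trajectory:
   there (u, v) is forced by continuity to be the one-sided derivative.
   Lipschitz continuity, with an arbitrary constant, does not depend on the
   norm of the plane and is imposed on each coordinate. *)
Definition admissible (R : realType) (a b : R) (x y u v : R -> R) : Prop :=
  [/\ {within `[a, b], continuous x} /\ {within `[a, b], continuous y},
      forall t : R, t \in `]a, b[ -> is_derive t 1 x (u t) /\ is_derive t 1 y (v t),
      exists k : R, k.-lipschitz_(`[a, b]) u /\ k.-lipschitz_(`[a, b]) v
    & {ae (@lebesgue_measure R), forall t : R, t \in `]a, b[ ->
        [/\ derivable u t 1, derivable v t 1
          & enorm (derive1 u t) (derive1 v t) <= 1]}].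

(* An admissible trajectory of duration T from the position and velocity of
   (x, y) at time a to its position and velocity at time b. *)
Definition transfer (R : realType) (x y : R -> R) (a b T : R) : Prop :=
  exists X Y U V : R -> R,
  [/\ admissible 0 T X Y U V,
      X 0 = x a /\ Y 0 = y a, U 0 = derive1 x a /\ V 0 = derive1 y a,
      X T = x b /\ Y T = y b & U T = derive1 x b /\ V T = derive1 y b].

Definition minimal_time_path (R : realType) (eps : R) (x y : R -> R) : Prop :=
  forall a b : R, - eps < a -> a <= b -> b < eps ->
  forall T : R, 0 <= T -> transfer x y a b T -> b - a <= T.

Definition vec2 (R : realType) (a b : R) : 'cV[R]_2 :=
  \col_(i < 2) nth 0 [:: a; b] i.

Definition mx2 (R : realType) (a b c d : R) : 'M[R]_2 :=
  \matrix_(i < 2, j < 2) nth 0 (nth [::] [:: [:: a; b]; [:: c; d]] i) j.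

(* Range of the rotation angle theta.  The acceleration of an extremal is p / |p|
   for a vector p moving affinely along a line of direction
   +- (- sin theta, cos theta), so theta has to represent the direction of every
   line of the plane exactly once.  On the open interval ]-pi/2, pi/2[ the
   horizontal direction is missed, although it occurs: the path
   x t = profile_g t - t, y t = profile_f t is a minimal time path on ]-1, 1[
   with p = (t, 1).  Hence the closed right end point. *)
Definition angle_range (R : realType) : interval R := `]- (pi / 2), pi / 2].

(* Main.v *)
Require Import Defs.
From mathcomp Require Import ring lra.

(** Write [w = (a, b)] for the acceleration and [n = (- b, a)] for its normal
    field.  The heart of the matter is Pontryagin's principle: [w] is parallel,
    at every instant, to one nonzero affine vector function [p], the costate.
    For this control problem linear algebra suffices.  Consider, on [[-r, r]],
    the linear map sending a scalar function [k] to the four moments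
    [int k n] and [int s k n].

    If the map is onto, some [k] makes the moments of [k n] equal to those of
    [w], and [h = - w + k n] has vanishing moments ([unit_gram_transfer]).
    Adding [e h] to the acceleration then changes neither the final position nor
    the final velocity, and as [w . h = -1] the new acceleration stays, for small
    [e > 0], at a positive distance from the unit circle.  Such slack can be
    traded for time: running the path slightly too fast leaves an error in the
    end velocities only, which a small cubic corrects ([slack_transfer]).  That
    contradicts minimality.

    So the map is never onto, which means that its Gram matrix is singular, and
    a vector of the kernel is precisely an affine [p] with [p . n = 0] on
    [[-r, r]].  The kernels shrink as [r] grows and have finite dimension, so one
    [p] serves for all [r] ([singular_gram_dependent], [affine_costate]).

    If [p] ran along a line through the origin, continuity would make [w]
    constant ([costate_nondegenerate]).  Hence [p] never vanishes, and up to a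
    global sign [w = p / |p|] ([costate_orientation]).  In the frame given by
    the direction of the line traced by [p] and the normal of this line, and with
    time measured from the instant when [p] is closest to the origin, [w] is
    [(1, s) / sqrt (1 + s^2)] up to signs ([costate_parameters]).  These are the
    second derivatives of the two profiles, so integrating twice gives the path.

    Conversely the path determines [w]; two accelerations of this form agree only
    if the corresponding affine functions are parallel and point the same way at
    all times, and comparing the coefficients of their cross product gives the
    uniqueness of the parameters ([profile_acceleration_inj]). *)

Set Implicit Arguments.
Unset Strict Implicit.
Unset Printing Implicit Defensive.

Local Open Scope classical_set_scope.
Local Open Scope ring_scope.

(** * Derivatives of real functions *)

(** A plain proposition in place of the class [is_derive], so that applying a
    lemma never triggers instance search on a variable function. *)
Definition has_derivative (R : realType) (F : R -> R) (t d : R) : Prop :=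
  is_derive t 1 F d.

Lemma derivative_continuous (R : realType) (F : R -> R) (t d : R) :
  has_derivative F t d -> {for t, continuous F}.
Proof.
by move=> [dF _]; apply/differentiable_continuous/derivable1_diffP.
Qed.

Lemma derivative_within (R : realType) (F f : R -> R) (a b : R) :
  (forall t, t \in `[a, b] -> has_derivative F t (f t)) ->
  {within `[a, b], continuous F}.
Proof.
by move=> dF; apply: derivable_within_continuous => t /dF[].
Qed.

Lemma derivative_eq (R : realType) (F : R -> R) (t d e : R) :
  has_derivative F t d -> d = e -> has_derivative F t e.
Proof. by move=> dF <-. Qed.

Lemma derivative_cst (R : realType) (t c : R) : has_derivative (fun=> c) t 0.
Proof. exact: (is_derive_cst c). Qed.

Lemma derivative_id (R : realType) (t : R) : has_derivative (fun s => s) t 1.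
Proof. exact: (is_derive_id t). Qed.

Lemma derivative_add (R : realType) (F G : R -> R) (t f g : R) :
  has_derivative F t f -> has_derivative G t g ->
  has_derivative (fun s => F s + G s) t (f + g).
Proof. by move=> dF dG; exact: (@is_deriveD _ _ _ F G _ _ _ _ dF dG). Qed.

Lemma derivative_mul (R : realType) (F G : R -> R) (t f g : R) :
  has_derivative F t f -> has_derivative G t g ->
  has_derivative (fun s => F s * G s) t (F t * g + G t * f).
Proof. by move=> dF dG; exact: (@is_deriveM _ _ F G _ _ _ _ dF dG). Qed.

Lemma derivative_scale (R : realType) (F : R -> R) (t c f : R) :
  has_derivative F t f -> has_derivative (fun s => c * F s) t (c * f).
Proof. by move=> dF; exact: (@is_deriveZ _ _ _ F c _ _ _ dF). Qed.

Lemma derivative_comp (R : realType) (F G : R -> R) (t f g : R) :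
  has_derivative F (G t) f -> has_derivative G t g ->
  has_derivative (fun s => F (G s)) t (f * g).
Proof. by move=> dF dG; exact: (@is_derive1_comp _ F G _ _ _ dF dG). Qed.

Lemma derivative_affine (R : realType) (t c k : R) :
  has_derivative (fun s => c + k * s) t k.
Proof.
apply: derivative_eq.
  apply: derivative_add; first exact: derivative_cst.
  by apply: derivative_scale; exact: derivative_id.
by rewrite add0r mulr1.
Qed.

Lemma mean_value (R : realType) (F f : R -> R) (a b : R) : a <= b ->
  (forall t, t \in `[a, b] -> has_derivative F t (f t)) ->
  exists2 c, c \in `[a, b] & F b - F a = f c * (b - a).
Proof.
move=> ab dF; apply: (@MVT_segment _ F f a b ab).
- by move=> t /subset_itv_oo_cc tab; exact: dF.
- exact: derivative_within dF.
Qed.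

Lemma eq_increment (R : realType) (F G f : R -> R) (a b : R) : a <= b ->
  (forall t, t \in `[a, b] -> has_derivative F t (f t)) ->
  (forall t, t \in `[a, b] -> has_derivative G t (f t)) ->
  F b - F a = G b - G a.
Proof.
move=> ab dF dG.
have dFG t : t \in `[a, b] ->
    has_derivative (fun s => F s + -1 * G s) t (cst 0 t).
  move=> tab; apply: derivative_eq.
    apply: derivative_add; first exact: dF.
    by apply: derivative_scale; exact: dG.
  by rewrite mulN1r subrr.
have [c _] := mean_value ab dFG; rewrite mul0r => /=; lra.
Qed.

Lemma nondecreasing_derivative (R : realType) (F f : R -> R) (a b : R) :
  a <= b ->
  (forall t, t \in `[a, b] -> has_derivative F t (f t)) ->
  (forall t, t \in `[a, b] -> 0 <= f t) -> F a <= F b.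
Proof.
move=> ab dF f0; have [c cab E] := mean_value ab dF.
by rewrite -subr_ge0 E mulr_ge0 ?f0 ?subr_ge0.
Qed.

Lemma lipschitz_derivative (R : realType) (F f : R -> R) (a b k : R) :
  (forall t, t \in `[a, b] -> has_derivative F t (f t)) ->
  (forall t, t \in `[a, b] -> `|f t| <= k) ->
  k.-lipschitz_(`[a, b]) F.
Proof.
move=> dF fk [s t] [/= sab tab].
wlog st : s t sab tab / s <= t => [H|].
  have [/H|/ltW/H] := leP s t; first exact.
  by rewrite distrC [X in _ -> _ <= _ * X]distrC; exact.
rewrite /= in sab tab; move: sab tab; rewrite !in_itv /= => /andP[s1 s2] /andP[t1 t2].
have sub r : r \in `[s, t] -> r \in `[a, b].
  rewrite !in_itv /= => /andP[r1 r2]; apply/andP; split; lra.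
have [|c cab E] := @mean_value _ F f s t st; first by move=> r /sub/dF.
rewrite distrC E normrM [X in _ <= _ * X]distrC ler_wpM2r //.
by apply: fk; exact: sub.
Qed.


(** * Trading slack in the acceleration for time *)

Lemma derivative_quadratic (R : realType) (a b c t : R) :
  has_derivative (fun s => a + s * (b + c * s)) t (b + 2 * c * t).
Proof.
apply: derivative_eq.
  apply: derivative_add; first exact: derivative_cst.
  by apply: derivative_mul; [exact: derivative_id|exact: derivative_affine].
by rewrite /=; ring.
Qed.

Lemma derivative_cubic (R : realType) (a b c t : R) :
  has_derivative (fun s => s * (a + s * (b + c * s))) t
    (a + t * (2 * b + 3 * c * t)).
Proof.
apply: derivative_eq.
  by apply: derivative_mul; [exact: derivative_id|exact: derivative_quadratic].
by rewrite /=; ring.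
Qed.

(** Running the path at speed [1 + kappa] keeps the end positions and multiplies
    the end velocities by [1 + kappa].  The cubic added here is the Hermite
    interpolant vanishing at both ends with end slopes [- kappa p] and
    [- kappa q], where [p] and [q] are the prescribed end velocities; it restores
    these velocities and its acceleration [kappa e] is of order [kappa]. *)
Lemma rescale_path (R : realType) (r kappa K : R) (X U w : R -> R) :
  0 < r -> 0 < kappa <= 1 ->
  (forall t, t \in `[- r, r] ->
     has_derivative X t (U t) /\ has_derivative U t (w t)) ->
  4 * (`|U (- r)| + `|U r|) / r <= K ->
  exists Z V W e : R -> R,
    let T := 2 * r / (1 + kappa) in
    [/\ forall s, s \in `[0, T] ->
          has_derivative Z s (V s) /\ has_derivative V s (W s),
        forall s, s \in `[0, T] -> let t := - r + (1 + kappa) * s in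
          t \in `[- r, r] /\ W s = (1 + kappa) ^+ 2 * w t + kappa * e s,
        forall s, s \in `[0, T] -> `|e s| <= K,
        Z 0 = X (- r) /\ V 0 = U (- r)
      & Z T = X r /\ V T = U r].
Proof.
move=> r0 /andP[k0 k1] dX hK.
set T := 2 * r / (1 + kappa).
have k10 : 1 + kappa != 0 by rewrite gt_eqF //; lra.
have T0 : 0 < T by rewrite /T divr_gt0 //; lra.
have TE : (1 + kappa) * T = 2 * r by rewrite /T; field.
have rT : r <= T by nra.
have Tn : T != 0 by rewrite gt_eqF.
set p := U (- r); set q := U r.
pose b := - kappa * - ((2 * p + q) / T).
pose c := - kappa * ((p + q) / T ^+ 2).
pose e s := - (- 2 * (2 * p + q) / T + 6 * (p + q) / T ^+ 2 * s).
exists (fun s => X (- r + (1 + kappa) * s) +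
                 s * (- kappa * p + s * (b + c * s))).
exists (fun s => (1 + kappa) * U (- r + (1 + kappa) * s) +
                 (- kappa * p + s * (2 * b + 3 * c * s))).
exists (fun s => (1 + kappa) ^+ 2 * w (- r + (1 + kappa) * s) + kappa * e s).
exists e.
have inr s : s \in `[0, T] -> - r + (1 + kappa) * s \in `[- r, r].
  by rewrite !in_itv /= => /andP[s0 sT]; apply/andP; split; nra.
have endT : - r + (1 + kappa) * T = r by rewrite TE; ring.
split=> /=.
- move=> s /inr /dX[dX1 dU1]; split; apply: derivative_eq.
  + apply: derivative_add; last exact: derivative_cubic.
    by apply: derivative_comp; [exact: dX1|exact: derivative_affine].
  + by rewrite /=; ring.
  + apply: derivative_add; last exact: derivative_quadratic.
    apply: derivative_scale.
    by apply: derivative_comp; [exact: dU1|exact: derivative_affine].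
  + by rewrite /e /b /c; field.
- by move=> s /inr.
- move=> s; rewrite in_itv /= => /andP[s0 sT].
  have -> : e s = ((4 - 6 * (s / T)) * p + (2 - 6 * (s / T)) * q) / T.
    by rewrite /e; field.
  have z0 : 0 <= s / T by rewrite divr_ge0 // ltW.
  have z1 : s / T <= 1 by rewrite ler_pdivrMr // mul1r.
  apply: le_trans hK; rewrite normrM [`|T^-1|]gtr0_norm ?invr_gt0 //.
  apply: ler_pM; rewrite ?invr_ge0 ?(ltW T0) //; last by rewrite lef_pV2.
  rewrite mulrDr; apply: le_trans (ler_normD _ _) _.
  by rewrite !normrM lerD // ler_wpM2r // ler_norml; apply/andP; split; lra.
- by rewrite !mul0r !mulr0 !addr0 /p; split=> //; ring.
- rewrite !endT -/q /b /c; split; first by field.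
  by field.
Qed.

(** Two-sided derivatives at the end points as well give continuity and the
    Lipschitz bound directly from the mean value inequality. *)
Lemma admissible_intro (R : realType) (T : R) (X Y U V u v : R -> R) :
  (forall t, t \in `[0, T] -> has_derivative X t (U t) /\ has_derivative U t (u t)) ->
  (forall t, t \in `[0, T] -> has_derivative Y t (V t) /\ has_derivative V t (v t)) ->
  (forall t, t \in `[0, T] -> u t ^+ 2 + v t ^+ 2 <= 1) ->
  admissible 0 T X Y U V.
Proof.
move=> dX dY uv; split.
- split; [apply: (@derivative_within _ X U)|apply: (@derivative_within _ Y V)].
    by move=> t /dX[].
  by move=> t /dY[].
- by move=> t /subset_itv_oo_cc tT; split; [exact: (dX t tT).1|exact: (dY t tT).1].
- exists 1; split;
    [apply: (@lipschitz_derivative _ U u)|apply: (@lipschitz_derivative _ V v)].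
  + by move=> t /dX[].
  + move=> t /uv uv1; rewrite -(@expr_le1 _ 2) // real_normK ?num_real //.
    by have := sqr_ge0 (v t); lra.
  + by move=> t /dY[].
  + move=> t /uv uv1; rewrite -(@expr_le1 _ 2) // real_normK ?num_real //.
    by have := sqr_ge0 (u t); lra.
- apply: aeW => t /subset_itv_oo_cc tT.
  have [_ [dU Uu]] := dX t tT; have [_ [dV Vv]] := dY t tT.
  split=> //; rewrite !derive1E Uu Vv /enorm -[leRHS]sqrtr1 ler_wsqrtr //.
  exact: uv.
Qed.

(** The rescaled path has acceleration [(1 + kappa)^2 w + kappa e] with [e]
    bounded independently of [kappa]; for small [kappa] both contributions of
    order [kappa] fit into the slack [delta]. *)
Lemma slack_transfer (R : realType) (r delta : R) (x y X Y U V u v : R -> R) :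
  0 < r -> 0 < delta ->
  (forall t, t \in `[- r, r] -> has_derivative X t (U t) /\ has_derivative U t (u t)) ->
  (forall t, t \in `[- r, r] -> has_derivative Y t (V t) /\ has_derivative V t (v t)) ->
  (forall t, t \in `[- r, r] -> u t ^+ 2 + v t ^+ 2 <= 1 - delta) ->
  (forall t, t = - r \/ t = r ->
    [/\ X t = x t, Y t = y t, U t = derive1 x t & V t = derive1 y t]) ->
  exists2 T, 0 <= T < 2 * r & transfer x y (- r) r T.
Proof.
move=> r0 d0 dX dY uv ends.
have [K K0 [KX KY]] : exists2 K, 0 <= K & 4 * (`|U (- r)| + `|U r|) / r <= K /\
    4 * (`|V (- r)| + `|V r|) / r <= K.
  exists (4 * (`|U (- r)| + `|U r|) / r + 4 * (`|V (- r)| + `|V r|) / r).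
    by rewrite addr_ge0 // divr_ge0 ?mulr_ge0 ?addr_ge0 ?(ltW r0).
  by split; [rewrite lerDl|rewrite lerDr];
    rewrite divr_ge0 ?mulr_ge0 ?addr_ge0 ?(ltW r0).
have den : 0 < delta + 31 + 4 * K ^+ 2 by have := sqr_ge0 K; lra.
(* [31] bounds [((1 + kappa)^5 - 1) / kappa], and [4 K^2] collects the two
   correction terms; the summand [delta] only keeps [kappa <= 1]. *)
pose kappa := delta / (delta + 31 + 4 * K ^+ 2).
have k0 : 0 < kappa by rewrite divr_gt0.
have kE : kappa * (delta + 31 + 4 * K ^+ 2) = delta.
  by rewrite /kappa divfK // gt_eqF.
have k1 : kappa <= 1.
  by rewrite /kappa ler_pdivrMr // mul1r; have := sqr_ge0 K; lra.
have k01 : 0 < kappa <= 1 by rewrite k0 k1.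
have [Z1 [V1 [W1 [e1 /= [dZ1 W1E e1K [Z10 V10] [Z1T V1T]]]]]] :=
  rescale_path r0 k01 dX KX.
have [Z2 [V2 [W2 [e2 /= [dZ2 W2E e2K [Z20 V20] [Z2T V2T]]]]]] :=
  rescale_path r0 k01 dY KY.
exists (2 * r / (1 + kappa)).
  apply/andP; split; first by rewrite divr_ge0 //; lra.
  by rewrite ltr_pdivrMr; nra.
have [xm ym um vm] := ends (- r) (or_introl erefl).
have [xp yp up vp] := ends r (or_intror erefl).
exists Z1, Z2, V1, V2; split; rewrite -?xm -?ym -?um -?vm -?xp -?yp -?up -?vp //.
apply: (@admissible_intro _ _ Z1 Z2 V1 V2 W1 W2) => // s sT.
have [tr ->] := W1E s sT; have [_ ->] := W2E s sT.
(* [(A + B)^2 <= (1 + kappa) A^2 + (1 + 1 / kappa) B^2] with [B = kappa e]. *)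
have split_square (A e : R) : `|e| <= K ->
    (A + kappa * e) ^+ 2 <= (1 + kappa) * A ^+ 2 + 2 * kappa * K ^+ 2.
  move=> eK.
  have eK2 : e ^+ 2 <= K ^+ 2.
    by rewrite -[leLHS]real_normK ?num_real // lerXn2r ?nnegrE.
  have -> : (A + kappa * e) ^+ 2 = (1 + kappa) * A ^+ 2 +
      (1 + kappa) * kappa * e ^+ 2 - kappa * (A - e) ^+ 2 by ring.
  have := sqr_ge0 (A - e); have := sqr_ge0 e; nra.
apply: le_trans (lerD (split_square _ _ (e1K s sT)) (split_square _ _ (e2K s sT))) _.
move: (uv _ tr); set z := - r + _.
have pow5 : (1 + kappa) ^+ 5 <= 1 + 31 * kappa.
  have -> : (1 + kappa) ^+ 5 = 1 + kappa * (5 + 10 * kappa + 10 * kappa ^+ 2 +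
     5 * kappa ^+ 3 + kappa ^+ 4) by ring.
  have k2 : kappa ^+ 2 <= 1 by rewrite exprn_ile1 // ltW.
  have k3 : kappa ^+ 3 <= 1 by rewrite exprn_ile1 // ltW.
  have k4 : kappa ^+ 4 <= 1 by rewrite exprn_ile1 // ltW.
  by nra.
have := sqr_ge0 (u z); have := sqr_ge0 (v z).
move=> v0 u0 uvz.
have -> : (1 + kappa) * ((1 + kappa) ^+ 2 * u z) ^+ 2 + 2 * kappa * K ^+ 2 +
   ((1 + kappa) * ((1 + kappa) ^+ 2 * v z) ^+ 2 + 2 * kappa * K ^+ 2) =
   (1 + kappa) ^+ 5 * (u z ^+ 2 + v z ^+ 2) + 4 * kappa * K ^+ 2 by ring.
have uv1 : u z ^+ 2 + v z ^+ 2 <= 1 by lra.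
apply: (@le_trans _ _ ((1 + 31 * kappa) * (u z ^+ 2 + v z ^+ 2) + 4 * kappa * K ^+ 2)).
  by rewrite lerD2r ler_wpM2r // addr_ge0.
nra.
Qed.

(** * Moments on a symmetric interval *)

Lemma continuous_sum_at (R : realType) (n : nat) (F : 'I_n -> R -> R) (t : R) :
  (forall i, {for t, continuous (F i)}) ->
  {for t, continuous (fun s => \sum_i F i s)}.
Proof. by move=> cF; apply: cvg_big => [|i _]; [exact: add_continuous|exact: cF]. Qed.

Lemma continuous_mul_at (R : realType) (F G : R -> R) (t : R) :
  {for t, continuous F} -> {for t, continuous G} ->
  {for t, continuous (fun s => F s * G s)}.
Proof. by move=> cF cG; exact: (@continuousM _ _ F G). Qed.

Lemma continuous_add_at (R : realType) (F G : R -> R) (t : R) :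
  {for t, continuous F} -> {for t, continuous G} ->
  {for t, continuous (fun s => F s + G s)}.
Proof. by move=> cF cG; exact: (@continuousD _ _ _ F G). Qed.

Lemma continuous_cst_at (R : realType) (c t : R) :
  {for t, continuous (fun=> c : R)}.
Proof. exact: cst_continuous. Qed.

Lemma continuous_id_at (R : realType) (t : R) :
  {for t, continuous (fun s : R => s)}.
Proof. exact: (derivative_continuous (derivative_id t)). Qed.

Lemma continuous_within (R : realType) (eps r : R) (f : R -> R) :
  r < eps -> {in `]- eps, eps[, continuous f} ->
  {within `[- r, r], continuous f}.
Proof.
move=> re cf; apply/continuous_in_subspaceT => z.
rewrite inE /= in_itv /= => /andP[z1 z2].
by apply: cf; rewrite in_itv /=; apply/andP; split; lra.
Qed.

(** The integral starts to the left of [- r], so that its upper end can move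
    both ways around every point of [[- r, r]]: the primitive has two-sided
    derivatives at the end points too. *)
Lemma primitive_exists (R : realType) (eps r : R) (f : R -> R) :
  0 < r -> r < eps -> {in `]- eps, eps[, continuous f} ->
  exists F : R -> R, F (- r) = 0 /\
    forall t, t \in `[- r, r] -> has_derivative F t (f t).
Proof.
move=> r0 re cf.
pose rho := (r + eps) / 2.
pose P t := (\int[@lebesgue_measure R]_(s in `[- rho, t]) f s)%R.
exists (fun t => P t + - P (- r)); split; first by rewrite subrr.
move=> t; rewrite in_itv /= => /andP[t1 t2].
have rr : r < rho by rewrite /rho; lra.
have re' : rho < eps by rewrite /rho; lra.
have fi : (@lebesgue_measure R).-integrable `[- rho, rho] (EFin \o f).
  apply: continuous_compact_integrable; first exact: segment_compact.
  apply/continuous_in_subspaceT => z; rewrite inE /= in_itv /= => /andP[z1 z2].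
  by apply: cf; rewrite in_itv /=; apply/andP; split; lra.
have tr : t < rho by lra.
have rt : - rho < t by lra.
have [|dP P't] := continuous_FTC1_closed tr fi rt.
  by apply: cf; rewrite in_itv /=; apply/andP; split; lra.
apply: derivative_eq; first apply: derivative_add; last exact: addr0.
  by apply: DeriveDef; [exact: dP|rewrite -derive1E; exact: P't].
exact: derivative_cst.
Qed.

Definition sym_integral (R : realType) (r : R) (f : R -> R) : R :=
  (\int[@lebesgue_measure R]_(s in `[- r, r]) f s)%R.

Lemma sym_integral_primitive (R : realType) (eps r : R) (f F : R -> R) :
  0 < r -> r < eps -> {in `]- eps, eps[, continuous f} ->
  (forall t, t \in `[- r, r] -> has_derivative F t (f t)) ->
  sym_integral r f = F r - F (- r).
Proof.
move=> r0 re cf dF; rewrite /sym_integral /Rintegral.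
have rr : - r < r by lra.
rewrite (continuous_FTC2 rr (continuous_within re cf) (F := F)) //.
  have := derivative_within dF => /(continuous_within_itvP _ rr)[_ Fm Fp].
  by split=> // t /subset_itv_oo_cc /dF[].
by move=> t /subset_itv_oo_cc /dF[_ dFt]; rewrite derive1E.
Qed.

Lemma derivative_sum (R : realType) (n : nat) (F : 'I_n -> R -> R)
    (f : 'I_n -> R) (t : R) :
  (forall i, has_derivative (F i) t (f i)) ->
  has_derivative (fun s => \sum_i F i s) t (\sum_i f i).
Proof.
by move=> dF; have := is_derive_sum dF; rewrite fct_sumE.
Qed.

Lemma sym_integral_lin (R : realType) (eps r : R) (n : nat)
    (c : 'I_n -> R) (f : 'I_n -> R -> R) :
  0 < r -> r < eps -> (forall i, {in `]- eps, eps[, continuous (f i)}) ->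
  sym_integral r (fun s => \sum_i c i * f i s) =
  \sum_i c i * sym_integral r (f i).
Proof.
move=> r0 re cf.
have /choice[F dF] : forall i, exists F : R -> R,
    F (- r) = 0 /\ forall t, t \in `[- r, r] -> has_derivative F t (f i t).
  by move=> i; exact: primitive_exists r0 re (cf i).
have dS t : t \in `[- r, r] ->
    has_derivative (fun s => \sum_i c i * F i s) t (\sum_i c i * f i t).
  move=> tr; apply: derivative_sum => i; apply: derivative_scale.
  exact: (dF i).2.
rewrite (sym_integral_primitive r0 re _ dS) => [|t te].
  rewrite -sumrB; apply: eq_bigr => i _.
  by rewrite (sym_integral_primitive r0 re (cf i) (dF i).2) mulrBr.
apply: continuous_sum_at => i; apply: continuous_mul_at; last exact: cf.
exact: continuous_cst_at.
Qed.

Lemma sym_integral_eq0 (R : realType) (eps r : R) (f : R -> R) :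
  0 < r -> r < eps -> {in `]- eps, eps[, continuous f} ->
  (forall t, t \in `[- r, r] -> 0 <= f t) ->
  sym_integral r f = 0 -> forall t, t \in `]- r, r[ -> f t = 0.
Proof.
move=> r0 re cf f0 I0 t tr.
have [F [F0 dF]] := primitive_exists r0 re cf.
have := sym_integral_primitive r0 re cf dF; rewrite I0 F0 subr0 => /esym Fr.
have F_eq0 s : s \in `[- r, r] -> F s = 0.
  rewrite in_itv /= => /andP[s1 s2]; apply/eqP; rewrite eq_le; apply/andP; split.
    rewrite -Fr; apply: (@nondecreasing_derivative _ F f) => // z.
      by rewrite in_itv /= => /andP[z1 z2]; apply: dF; rewrite in_itv /=; lra.
    by rewrite in_itv /= => /andP[z1 z2]; apply: f0; rewrite in_itv /=; lra.
  rewrite -F0; apply: (@nondecreasing_derivative _ F f) => // z.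
    by rewrite in_itv /= => /andP[z1 z2]; apply: dF; rewrite in_itv /=; lra.
  by rewrite in_itv /= => /andP[z1 z2]; apply: f0; rewrite in_itv /=; lra.
have [_ <-] := dF t (subset_itv_oo_cc tr).
have [_ <-] : is_derive t 1 (fun=> 0 : R) 0 := derivative_cst t 0.
apply: near_eq_derive.
near=> z; apply: F_eq0; apply: subset_itv_oo_cc.
by near: z; exact: near_in_itvoo.
Unshelve. all: by end_near. Qed.

(** Vanishing of the zeroth and first moments of [f] is what makes the double
    primitive of [f] starting at rest return to rest at the origin. *)
Lemma double_primitive (R : realType) (eps r : R) (f : R -> R) :
  0 < r -> r < eps -> {in `]- eps, eps[, continuous f} ->
  sym_integral r f = 0 -> sym_integral r (fun s => s * f s) = 0 ->
  exists H K : R -> R,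
    (forall t, t \in `[- r, r] ->
       has_derivative K t (H t) /\ has_derivative H t (f t)) /\
    (forall t, t = - r \/ t = r -> K t = 0 /\ H t = 0).
Proof.
move=> r0 re cf I0 I1.
pose rho := (r + eps) / 2.
have rr : r < rho by rewrite /rho; lra.
have re' : rho < eps by rewrite /rho; lra.
have rho0 : 0 < rho by lra.
have [P [_ dP]] := primitive_exists rho0 re' cf.
pose H s := P s + - P (- r).
have dH t : t \in `[- rho, rho] -> has_derivative H t (f t).
  move=> tr; apply: derivative_eq; last exact: addr0.
  by apply: derivative_add; [exact: dP|exact: derivative_cst].
have cH : {in `]- rho, rho[, continuous H}.
  by move=> t /subset_itv_oo_cc /dH; exact: derivative_continuous.
have sub t : t \in `[- r, r] -> t \in `[- rho, rho].
  by rewrite !in_itv /= => /andP[t1 t2]; apply/andP; split; lra.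
have [K [K0 dK]] := primitive_exists r0 rr cH.
have Hm : H (- r) = 0 by rewrite /H subrr.
have Hr : H r = 0.
  by have := sym_integral_primitive r0 re cf (fun t tr => dH t (sub t tr));
    rewrite I0 Hm subr0.
exists H, K; split=> [t tr|t]; first by split; [exact: dK|exact/dH/sub].
(* The first moment of [f] is the increment of [s H(s) - K(s)]. *)
have dsf t' : t' \in `[- r, r] ->
    has_derivative (fun s => s * H s + -1 * K s) t' (t' * f t').
  move=> tr; apply: derivative_eq.
    apply: derivative_add; last by apply: derivative_scale; exact: dK.
    by apply: derivative_mul; [exact: derivative_id|exact/dH/sub].
  by rewrite /=; ring.
have := sym_integral_primitive r0 re _ dsf; rewrite I1 Hr Hm K0.
move=> KE [->|->] //; split => //.
have : 0 = r * 0 + -1 * K r - (- r * 0 + -1 * 0).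
  apply: KE => s se; apply: continuous_mul_at; last exact: cf.
  exact: continuous_id_at.
lra.
Qed.

(** * Linear dependence and Gram matrices *)

Definition gram (R : realType) (n : nat) (N : 'I_n -> R -> R) (r : R) : 'M[R]_n :=
  \matrix_(i, j) sym_integral r (fun s => N i s * N j s).

Lemma mul_gram (R : realType) (eps r : R) (n : nat) (N : 'I_n -> R -> R)
    (v : 'rV[R]_n) (j : 'I_n) :
  0 < r -> r < eps -> (forall i, {in `]- eps, eps[, continuous (N i)}) ->
  (v *m gram N r) 0 j =
  sym_integral r (fun s => \sum_i v 0 i * (N i s * N j s)).
Proof.
move=> r0 re cN; rewrite (sym_integral_lin _ r0 re) => [|i t te].
  by rewrite mxE; apply: eq_bigr => i _; rewrite mxE.
by apply: continuous_mul_at; exact: cN.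
Qed.

(** The value of the quadratic form of the Gram matrix at [v] is the integral of
    the square of the combination of the family with coefficients [v]. *)
Lemma gram_kernel (R : realType) (eps r : R) (n : nat) (N : 'I_n -> R -> R)
    (v : 'rV[R]_n) :
  0 < r -> r < eps -> (forall i, {in `]- eps, eps[, continuous (N i)}) ->
  v *m gram N r = 0 ->
  forall t, t \in `]- r, r[ -> \sum_i v 0 i * N i t = 0.
Proof.
move=> r0 re cN vG0 t tr.
pose g s := \sum_i v 0 i * N i s.
have cg : {in `]- eps, eps[, continuous g}.
  move=> s se; apply: continuous_sum_at => i.
  by apply: continuous_mul_at; [exact: continuous_cst_at|exact: cN].
have cgg : {in `]- eps, eps[, continuous (fun s => g s * g s)}.
  by move=> s se; apply: continuous_mul_at; exact: cg.
have gN j : sym_integral r (fun s => g s * N j s) = 0.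
  rewrite -[RHS](_ : (v *m gram N r) 0 j = _); last by rewrite vG0 mxE.
  rewrite (mul_gram _ _ r0 re cN); congr sym_integral; apply/funext => s.
  by rewrite mulr_suml; apply: eq_bigr => i _; rewrite mulrA.
suff gg0 : sym_integral r (fun s => g s * g s) = 0.
  have /eqP := sym_integral_eq0 r0 re cgg (fun s _ => sqr_ge0 (g s)) gg0 tr.
  by rewrite mulf_eq0 orbb => /eqP.
transitivity (sym_integral r (fun s => \sum_j v 0 j * (g s * N j s))).
  congr sym_integral; apply/funext => s.
  by rewrite {2}/g mulr_sumr; apply: eq_bigr => j _; rewrite mulrCA.
rewrite (sym_integral_lin _ r0 re) => [|i s se].
  by rewrite big1 // => j _; rewrite gN mulr0.
by apply: continuous_mul_at; [exact: cg|exact: cN].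
Qed.

Lemma kernel_gram (R : realType) (eps r : R) (n : nat) (N : 'I_n -> R -> R)
    (v : 'rV[R]_n) :
  0 < r -> r < eps -> (forall i, {in `]- eps, eps[, continuous (N i)}) ->
  (forall t, t \in `[- r, r] -> \sum_i v 0 i * N i t = 0) ->
  v *m gram N r = 0.
Proof.
move=> r0 re cN vN0; apply/rowP => j; rewrite (mul_gram _ _ r0 re cN) mxE.
rewrite (sym_integral_primitive (F := fun=> 0) r0 re) ?subrr //.
  move=> t te; apply: continuous_sum_at => i.
  apply: continuous_mul_at; first exact: continuous_cst_at.
  by apply: continuous_mul_at; exact: cN.
move=> t tr; apply: derivative_eq; first exact: derivative_cst.
under eq_bigr do rewrite mulrA.
by rewrite -mulr_suml vN0 // mul0r.
Qed.

(** The kernels of the Gram matrices decrease as the interval grows; one of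
    least dimension is contained in all the others. *)
Lemma singular_gram_dependent (R : realType) (eps : R) (n : nat)
    (N : 'I_n -> R -> R) :
  0 < eps -> (forall i, {in `]- eps, eps[, continuous (N i)}) ->
  (forall r, 0 < r -> r < eps -> gram N r \notin unitmx) ->
  exists2 v : 'rV[R]_n, v != 0 &
    forall t, t \in `]- eps, eps[ -> \sum_i v 0 i * N i t = 0.
Proof.
move=> eps0 cN sing.
pose P k := `[< exists r, [/\ 0 < r, r < eps & \rank (gram N r) = k] >].
have exP : exists k, P k.
  exists (\rank (gram N (eps / 2))); apply/asboolP; exists (eps / 2).
  by split=> //; lra.
have ubP k : P k -> (k <= n)%N by move=> /asboolP[r [_ _ <-]]; exact: rank_leq_row.
have [k /asboolP[r [r0 re rk]] kmax] := ex_maxnP exP ubP.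
have : kermx (gram N r) != 0.
  by rewrite kermx_eq0 row_free_unit; exact: sing.
move=> /rowV0Pn[v vker v0]; exists v => // t.
rewrite in_itv /= => /andP[t1 t2].
have te : `|t| < eps by rewrite ltr_norml t1 t2.
pose m := Num.max r `|t|.
have me : m < eps by rewrite /m gt_max re te.
have rm : r <= m by rewrite /m le_max lexx.
have tm : `|t| <= m by rewrite /m le_max lexx orbT.
pose r' := (m + eps) / 2.
have r'0 : 0 < r' by rewrite /r'; lra.
have r'e : r' < eps by rewrite /r'; lra.
have ker_sub : (kermx (gram N r') <= kermx (gram N r))%MS.
  apply/rV_subP => u /sub_kermxP uG; apply/sub_kermxP.
  apply: (kernel_gram r0 re cN) => s; rewrite in_itv /= => /andP[s1 s2].
  apply: (gram_kernel r'0 r'e cN uG); rewrite in_itv /= /r'.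
  by apply/andP; split; lra.
have rk' : (\rank (gram N r') <= \rank (gram N r))%N.
  by rewrite rk; apply: kmax; apply/asboolP; exists r'.
have : (kermx (gram N r) <= kermx (gram N r'))%MS.
  rewrite -(mxrank_leqif_sup ker_sub) eqn_leq mxrankS //= !mxrank_ker.
  exact: leq_sub2l.
move=> /(submx_trans vker) /sub_kermxP vG.
apply: (gram_kernel r'0 r'e cN vG); rewrite in_itv /= -ltr_norml /r'; lra.
Qed.

(** * The costate *)

(** The integrands of the four moments: integrals against these functions are
    the net changes of velocity and, once the time of arrival is fixed, of
    position produced by an acceleration along the normal [(- b, a)]. *)
Definition normal_moments (R : realType) (a b : R -> R) (i : 'I_4) (s : R) : R :=
  nth 0 [:: - b s; a s; s * - b s; s * a s] i.

Lemma continuous_normal_moments (R : realType) (eps : R) (a b : R -> R) :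
  {in `]- eps, eps[, continuous a} -> {in `]- eps, eps[, continuous b} ->
  forall i, {in `]- eps, eps[, continuous (normal_moments a b i)}.
Proof.
move=> ca cb i t te.
have cN : {for t, continuous (fun s => - b s)}.
  by apply: (@continuousN _ _ _ b); exact: cb.
case: i => -[|[|[|[|//]]]] i4 //=.
- exact: ca.
- exact: (continuous_mul_at (@continuous_id_at _ t) cN).
- exact: (continuous_mul_at (@continuous_id_at _ t) (ca t te)).
Qed.

(** A combination of the family itself can be given any moments against the
    family: its coefficients solve the linear system of the Gram matrix. *)
Lemma unit_gram_solve (R : realType) (eps r : R) (n : nat)
    (N : 'I_n -> R -> R) (g : 'I_n -> R) :
  0 < r -> r < eps -> (forall i, {in `]- eps, eps[, continuous (N i)}) ->
  gram N r \in unitmx ->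
  exists k : R -> R, {in `]- eps, eps[, continuous k} /\
    forall j, sym_integral r (fun s => k s * N j s) = g j.
Proof.
move=> r0 re cN unitG.
pose mu := (\row_j g j) *m invmx (gram N r).
exists (fun s => \sum_i mu 0 i * N i s); split.
  move=> t te; apply: continuous_sum_at => i.
  by apply: continuous_mul_at; [exact: continuous_cst_at|exact: cN].
move=> j; have := mul_gram mu j r0 re cN.
rewrite mulmxKV // mxE => ->; congr sym_integral; apply/funext => s.
by rewrite mulr_suml; apply: eq_bigr => i _; rewrite mulrA.
Qed.

Lemma sym_integral_oppD (R : realType) (eps r : R) (f g : R -> R) :
  0 < r -> r < eps -> {in `]- eps, eps[, continuous f} ->
  {in `]- eps, eps[, continuous g} ->
  sym_integral r (fun s => - f s + g s) = - sym_integral r f + sym_integral r g.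
Proof.
move=> r0 re cf cg.
pose c (i : 'I_2) : R := if i == 0 then -1 else 1.
pose h (i : 'I_2) := if i == 0 then f else g.
have ch i : {in `]- eps, eps[, continuous (h i)} by rewrite /h; case: ifP.
have := sym_integral_lin c r0 re ch.
rewrite !big_ord_recl big_ord0 /c /h /= mulN1r mul1r addr0 => <-.
congr sym_integral; apply/funext => s.
by rewrite !big_ord_recl big_ord0 /= mulN1r mul1r addr0.
Qed.

(** For a suitable [k] the variation [- (a, b) + k (- b, a)] has vanishing
    moments, so adding a multiple of it preserves the end positions and
    velocities.  Its scalar product with [(a, b)] is [-1], so a small multiple of
    it moves the acceleration strictly inside the unit disk. *)
Lemma unit_gram_transfer (R : realType) (eps r : R) (x y a b : R -> R) :
  0 < r -> r < eps ->
  {in `]- eps, eps[, continuous a} -> {in `]- eps, eps[, continuous b} ->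
  (forall t, t \in `]- eps, eps[ -> a t ^+ 2 + b t ^+ 2 = 1) ->
  (forall t, t \in `]- eps, eps[ ->
     has_derivative x t (derive1 x t) /\ has_derivative (derive1 x) t (a t)) ->
  (forall t, t \in `]- eps, eps[ ->
     has_derivative y t (derive1 y t) /\ has_derivative (derive1 y) t (b t)) ->
  gram (normal_moments a b) r \in unitmx ->
  exists2 T, 0 <= T < 2 * r & transfer x y (- r) r T.
Proof.
move=> r0 re ca cb ab1 dx dy unitG.
have cN := continuous_normal_moments ca cb.
have cs : {in `]- eps, eps[, continuous (fun s : R => s)}.
  by move=> t _; exact: continuous_id_at.
have cM (f g : R -> R) : {in `]- eps, eps[, continuous f} ->
    {in `]- eps, eps[, continuous g} ->
    {in `]- eps, eps[, continuous (fun s => f s * g s)}.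
  by move=> cf cg t te; apply: continuous_mul_at; [exact: cf|exact: cg].
have [k [ck kE]] := unit_gram_solve
  (fun j => sym_integral r (fun s => nth 0 [:: a s; b s; s * a s; s * b s] j))
  r0 re cN unitG.
have sub t : t \in `[- r, r] -> t \in `]- eps, eps[.
  by rewrite !in_itv /= => /andP[t1 t2]; apply/andP; split; lra.
have variation (f g : R -> R) :
    {in `]- eps, eps[, continuous f} -> {in `]- eps, eps[, continuous g} ->
    sym_integral r (fun s => k s * g s) = sym_integral r f ->
    sym_integral r (fun s => k s * (s * g s)) = sym_integral r (fun s => s * f s) ->
    exists H K : R -> R,
    (forall t, t \in `[- r, r] ->
       has_derivative K t (H t) /\ has_derivative H t (- f t + k t * g t)) /\
    (forall t, t = - r \/ t = r -> K t = 0 /\ H t = 0).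
  move=> cf cg E0 E1.
  apply: (@double_primitive _ eps r (fun s => - f s + k s * g s)) => //.
  - move=> t te; apply: (@continuous_add_at _ (fun s => - f s)); last exact: (cM k g).
    by apply: (@continuousN _ _ _ f); exact: cf.
  - by rewrite (sym_integral_oppD r0 re) ?E0 ?addNr //; exact: cM.
  - rewrite (_ : (fun s => _) = fun s => - (s * f s) + k s * (s * g s)).
      have cKs := cM _ _ ck (cM _ _ cs cg).
      by rewrite (sym_integral_oppD r0 re (cM _ _ cs cf) cKs) E1 addNr.
    by apply/funext => s; ring.
have [|||H1 [K1 [dK1 end1]]] := variation a (fun s => - b s) ca.
- by move=> t te; apply: (@continuousN _ _ _ b); exact: cb.
- exact: (kE (Ordinal (isT : (0 < 4)%N))).
- exact: (kE (Ordinal (isT : (2 < 4)%N))).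
have [||H2 [K2 [dK2 end2]]] := variation b a cb ca.
- exact: (kE (Ordinal (isT : (1 < 4)%N))).
- exact: (kE (Ordinal (isT : (3 < 4)%N))).
have rr : - r <= r by lra.
have [c cr kmax] := EVT_max rr (continuous_within re (cM _ _ ck ck)).
(* The squared length of the varied acceleration is [(1 - e)^2 + e^2 k^2]; with
   [e (1 + max k^2) = 1] it is at most [1 - e]. *)
pose e := (1 + k c ^+ 2)^-1.
have den : 0 < 1 + k c ^+ 2 by have := sqr_ge0 (k c); lra.
have e0 : 0 < e by rewrite invr_gt0.
have eE : e * (1 + k c ^+ 2) = 1 by rewrite mulVf // gt_eqF.
apply: (@slack_transfer _ r e x y (fun s => x s + e * K1 s)
  (fun s => y s + e * K2 s) (fun s => derive1 x s + e * H1 s)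
  (fun s => derive1 y s + e * H2 s) (fun s => a s + e * (- a s + k s * - b s))
  (fun s => b s + e * (- b s + k s * a s))) => //.
- move=> t tr; have [dx1 dx2] := dx t (sub t tr); have [dK dH] := dK1 t tr.
  by split; apply: derivative_add => //; exact: derivative_scale.
- move=> t tr; have [dx1 dx2] := dy t (sub t tr); have [dK dH] := dK2 t tr.
  by split; apply: derivative_add => //; exact: derivative_scale.
- move=> t tr; have ab := ab1 t (sub t tr).
  have -> : (a t + e * (- a t + k t * - b t)) ^+ 2 +
      (b t + e * (- b t + k t * a t)) ^+ 2 =
      ((1 - e) ^+ 2 + e ^+ 2 * k t ^+ 2) * (a t ^+ 2 + b t ^+ 2) by ring.
  rewrite ab mulr1; have kt : k t ^+ 2 <= k c ^+ 2 by exact: kmax.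
  have : e ^+ 2 * k t ^+ 2 <= e ^+ 2 * k c ^+ 2 by rewrite ler_wpM2l ?sqr_ge0.
  have -> : e ^+ 2 * k c ^+ 2 = e * (e * (1 + k c ^+ 2)) - e ^+ 2 by ring.
  rewrite eE; lra.
- move=> t te; have [-> ->] := end1 t te; have [-> ->] := end2 t te.
  by rewrite !mulr0 !addr0.
Qed.

(** Pontryagin's principle for bounded acceleration: the costate is
    [(p0 + p1 t, q0 + q1 t)], and its existence says that the normal moments of
    the acceleration are linearly dependent. *)
Lemma affine_costate (R : realType) (eps : R) (x y a b : R -> R) :
  0 < eps -> minimal_time_path eps x y ->
  {in `]- eps, eps[, continuous a} -> {in `]- eps, eps[, continuous b} ->
  (forall t, t \in `]- eps, eps[ -> a t ^+ 2 + b t ^+ 2 = 1) ->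
  (forall t, t \in `]- eps, eps[ ->
     has_derivative x t (derive1 x t) /\ has_derivative (derive1 x) t (a t)) ->
  (forall t, t \in `]- eps, eps[ ->
     has_derivative y t (derive1 y t) /\ has_derivative (derive1 y) t (b t)) ->
  exists p0 p1 q0 q1 : R, ~ [/\ p0 = 0, p1 = 0, q0 = 0 & q1 = 0] /\
    forall t, t \in `]- eps, eps[ ->
      a t * (q0 + q1 * t) = b t * (p0 + p1 * t).
Proof.
move=> eps0 hmin ca cb ab1 dx dy.
have cN := continuous_normal_moments ca cb.
have [|v v0 vN] := singular_gram_dependent eps0 cN.
  move=> r r0 re; apply/negP => unitG.
  have [T /andP[T0 Tr] tr] := unit_gram_transfer r0 re ca cb ab1 dx dy unitG.
  have := hmin (- r) r _ _ re T T0 tr; lra.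
pose w i (i4 : (i < 4)%N) := v 0 (Ordinal i4).
exists (w 0%N isT), (w 2%N isT), (w 1%N isT), (w 3%N isT); split.
  move=> [z0 z2 z1 z3]; move/eqP: v0; apply; apply/rowP => i; rewrite mxE.
  case: i => -[|[|[|[|//]]]] i4.
  - by rewrite -[RHS]z0; congr (v 0 _); exact: val_inj.
  - by rewrite -[RHS]z1; congr (v 0 _); exact: val_inj.
  - by rewrite -[RHS]z2; congr (v 0 _); exact: val_inj.
  - by rewrite -[RHS]z3; congr (v 0 _); exact: val_inj.
move=> t te; have := vN t te; rewrite !big_ord_recl big_ord0.
have E i (j : 'I_4) (i4 : (i < 4)%N) : val j = i -> v 0 j = w i i4.
  by move=> ji; congr (v 0 _); exact: val_inj.
rewrite (E 0%N _ isT) // (E 1%N _ isT) // (E 2%N _ isT) // (E 3%N _ isT) //.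
rewrite /normal_moments /=; lra.
Qed.

Lemma continuous_within_sub (R : realType) (eps s t : R) (f : R -> R) :
  {in `]- eps, eps[, continuous f} -> s \in `]- eps, eps[ -> t \in `]- eps, eps[ ->
  {within `[s, t], continuous f}.
Proof.
rewrite !in_itv /= => cf /andP[s1 s2] /andP[t1 t2].
apply/continuous_in_subspaceT => z; rewrite inE /= in_itv /= => /andP[z1 z2].
by apply: cf; rewrite in_itv /=; apply/andP; split; lra.
Qed.

Lemma IVT_between (R : realType) (eps s t v : R) (f : R -> R) :
  {in `]- eps, eps[, continuous f} -> s \in `]- eps, eps[ -> t \in `]- eps, eps[ ->
  f s <= v <= f t ->
  exists2 c, c \in `]- eps, eps[ & f c = v.
Proof.
move=> cf se te /andP[sv vt].
have sub z w c : z \in `]- eps, eps[ -> w \in `]- eps, eps[ -> c \in `[z, w] ->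
    c \in `]- eps, eps[.
  rewrite !in_itv /= => /andP[z1 z2] /andP[w1 w2] /andP[c1 c2].
  by apply/andP; split; lra.
have [st|ts] := leP s t.
  have [|c cst E] := IVT (v := v) st (continuous_within_sub cf se te).
    by rewrite ge_min sv le_max vt orbT.
  by exists c => //; exact: sub cst.
have [|c cst E] := IVT (v := v) (ltW ts) (continuous_within_sub cf te se).
  by rewrite ge_min sv orbT le_max vt.
by exists c => //; exact: sub cst.
Qed.

Lemma constant_sign (R : realType) (eps : R) (f : R -> R) :
  {in `]- eps, eps[, continuous f} ->
  (forall t, t \in `]- eps, eps[ -> f t != 0) ->
  (forall t, t \in `]- eps, eps[ -> 0 < f t) \/
  (forall t, t \in `]- eps, eps[ -> f t < 0).
Proof.
move=> cf f0.
have [[s se fs]|npos] := pselect (exists2 s, s \in `]- eps, eps[ & 0 < f s).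
  left=> t te; rewrite lt_neqAle eq_sym f0 //= leNgt; apply/negP => ft.
  have [|c ce fc] := @IVT_between _ _ _ _ 0 _ cf te se; first by rewrite !ltW.
  by have := f0 c ce; rewrite fc eqxx.
right=> t te; rewrite lt_neqAle f0 //= leNgt; apply/negP => ft.
by apply: npos; exists t.
Qed.

(** A nonzero value at [t0] would force, by the intermediate value theorem
    applied to the square, a nonzero value elsewhere. *)
Lemma continuous_eq0_off_point (R : realType) (eps t0 : R) (f : R -> R) :
  0 < eps ->
  {in `]- eps, eps[, continuous f} ->
  (forall t, t \in `]- eps, eps[ -> t != t0 -> f t = 0) ->
  forall t, t \in `]- eps, eps[ -> f t = 0.
Proof.
move=> eps0 cf f0 t te; have [tt0|/f0->//] := eqVneq t t0.
apply/eqP/negPn/negP => ft.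
have [s se st] : exists2 s, s \in `]- eps, eps[ & s != t0.
  have [->|] := eqVneq t0 0; last first.
    by rewrite eq_sym => t00; exists 0 => //; rewrite in_itv /=; lra.
  by exists (eps / 2); [rewrite in_itv /=; lra|rewrite gt_eqF //; lra].
have cff : {in `]- eps, eps[, continuous (fun z => f z * f z)}.
  by move=> z ze; apply: continuous_mul_at; exact: cf.
have ff : 0 < f t * f t by rewrite lt_def mulf_neq0 //= -expr2 sqr_ge0.
have [|c ce fc] := @IVT_between _ _ _ _ (f t * f t / 2) _ cff se te.
  by rewrite f0 // mulr0; lra.
have [ct0|ct0] := eqVneq c t0; first by move: fc; rewrite ct0 -tt0; lra.
by move: fc; rewrite f0 // mulr0; lra.
Qed.

(** An affine vector function confined to a line fixes the direction of the
    acceleration except at one instant, hence, by continuity, its value. *)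
Lemma costate_nondegenerate (R : realType) (eps p0 p1 q0 q1 : R) (a b : R -> R) :
  0 < eps ->
  {in `]- eps, eps[, continuous a} -> {in `]- eps, eps[, continuous b} ->
  (forall t, t \in `]- eps, eps[ -> a t ^+ 2 + b t ^+ 2 = 1) ->
  ~ (exists k : R * R, forall t, t \in `]- eps, eps[ -> (a t, b t) = k) ->
  ~ [/\ p0 = 0, p1 = 0, q0 = 0 & q1 = 0] ->
  (forall t, t \in `]- eps, eps[ ->
     a t * (q0 + q1 * t) = b t * (p0 + p1 * t)) ->
  p0 * q1 - p1 * q0 != 0.
Proof.
move=> eps0 ca cb ab1 nonconst pq0 par; apply/negP => /eqP det0.
(* The costate is [(l0 + l1 t) (d1, d2)]. *)
have [d1 [d2 [l0 [l1 [dn ln pE]]]]] : exists d1 d2 l0 l1 : R,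
    [/\ 0 < d1 ^+ 2 + d2 ^+ 2, (l1 == 0) ==> (l0 != 0) &
     [/\ p0 = l0 * d1, p1 = l1 * d1, q0 = l0 * d2 & q1 = l1 * d2]].
  have [n0|n0] := eqVneq (p0 ^+ 2 + q0 ^+ 2) 0.
    have [p00 q00] : p0 = 0 /\ q0 = 0.
      move/eqP: n0; rewrite paddr_eq0 ?sqr_ge0 // !sqrf_eq0.
      by move=> /andP[/eqP-> /eqP->].
    exists p1, q1, 0, 1; rewrite !mul0r !mul1r oner_eq0; split=> //.
    rewrite lt_def addr_ge0 ?sqr_ge0 // andbT paddr_eq0 ?sqr_ge0 // !sqrf_eq0.
    by apply/negP => /andP[/eqP p10 /eqP q10]; apply: pq0; split.
  have n_gt0 : 0 < p0 ^+ 2 + q0 ^+ 2 by rewrite lt_def n0 addr_ge0 ?sqr_ge0.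
  exists p0, q0, 1, ((p0 * p1 + q0 * q1) / (p0 ^+ 2 + q0 ^+ 2)).
  rewrite oner_eq0 implybT !mul1r; split=> //; split=> //.
    rewrite mulrAC; apply: (mulIf n0); rewrite divfK //.
    transitivity ((p0 * p1 + q0 * q1) * p0 - q0 * (p0 * q1 - p1 * q0)); first by ring.
    by rewrite det0 mulr0 subr0.
  rewrite mulrAC; apply: (mulIf n0); rewrite divfK //.
  transitivity ((p0 * p1 + q0 * q1) * q0 + p0 * (p0 * q1 - p1 * q0)); first by ring.
  by rewrite det0 mulr0 addr0.
have comb_cont (k1 k2 : R) :
    {in `]- eps, eps[, continuous (fun t => k1 * a t + k2 * b t)}.
  move=> t te; have cc (f : R -> R) k cf :=
    @continuous_mul_at _ _ f t (@continuous_cst_at _ k t) cf.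
  exact: (continuous_add_at (cc _ _ (ca t te)) (cc _ _ (cb t te))).
have ortho t : t \in `]- eps, eps[ -> d2 * a t + - d1 * b t = 0.
  apply: (continuous_eq0_off_point (t0 := - (l0 / l1)) eps0 (comb_cont _ _)).
  move=> {}t te tl; have := par t te; case: pE => -> -> -> ->.
  move=> E; have : (l0 + l1 * t) * (d2 * a t + - d1 * b t) = 0.
    by move: E => /eqP; rewrite -subr_eq0 => /eqP <-; ring.
  move/eqP; rewrite mulf_eq0 => /orP[|/eqP//].
  have [l10|l10] := eqVneq l1 0.
    by move: ln; rewrite l10 eqxx /= mul0r addr0 => /negPf ->.
  move=> /eqP lt; case/eqP: tl; apply: (mulfI l10).
  by rewrite mulrN mulrCA divff // mulr1; lra.
(* [(a, b)] is parallel to [(d1, d2)], so this component has constant modulus. *)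
pose w t := d1 * a t + d2 * b t.
have w2 t : t \in `]- eps, eps[ -> w t ^+ 2 = d1 ^+ 2 + d2 ^+ 2.
  move=> te; have := ab1 t te; have := ortho t te => o u.
  transitivity ((d1 ^+ 2 + d2 ^+ 2) * (a t ^+ 2 + b t ^+ 2) -
     (d2 * a t + - d1 * b t) ^+ 2); first by rewrite /w; ring.
  by rewrite o u mulr1 expr0n subr0.
have zero_in : 0 \in `]- eps, eps[ by rewrite in_itv /=; lra.
have w0 t : t \in `]- eps, eps[ -> w t = w 0.
  move=> te; have wE : w t ^+ 2 = w 0 ^+ 2 by rewrite !w2.
  have wn z : z \in `]- eps, eps[ -> w z != 0.
    by move=> ze; rewrite -sqrf_eq0 w2 // gt_eqF.
  move/eqP: wE; rewrite eqf_sqr => /orP[/eqP//|/eqP wE].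
  by have [s|s] := constant_sign (comb_cont d1 d2) wn;
    have := s t te; have := s 0 zero_in; move: wE; rewrite /w; lra.
apply: nonconst; exists (w 0 * d1 / (d1 ^+ 2 + d2 ^+ 2), w 0 * d2 / (d1 ^+ 2 + d2 ^+ 2)).
move=> t te; rewrite -(w0 t te); have o := ortho t te.
have dn0 : d1 ^+ 2 + d2 ^+ 2 != 0 by rewrite gt_eqF.
congr pair; apply: (mulIf dn0); rewrite divfK //.
  transitivity (w t * d1 + d2 * (d2 * a t + - d1 * b t)).
    by rewrite /w; ring.
  by rewrite o mulr0 addr0.
transitivity (w t * d2 - d1 * (d2 * a t + - d1 * b t)).
  by rewrite /w; ring.
by rewrite o mulr0 subr0.
Qed.

(** The scalar product of the acceleration with a costate that never vanishes
    never vanishes either, so a global change of sign makes it positive. *)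
Lemma costate_orientation (R : realType) (eps p0 p1 q0 q1 : R) (a b : R -> R) :
  {in `]- eps, eps[, continuous a} -> {in `]- eps, eps[, continuous b} ->
  (forall t, t \in `]- eps, eps[ -> a t ^+ 2 + b t ^+ 2 = 1) ->
  p0 * q1 - p1 * q0 != 0 ->
  (forall t, t \in `]- eps, eps[ ->
     a t * (q0 + q1 * t) = b t * (p0 + p1 * t)) ->
  exists p0' p1' q0' q1' : R, p0' * q1' - p1' * q0' != 0 /\
    forall t, t \in `]- eps, eps[ ->
     a t * (q0' + q1' * t) = b t * (p0' + p1' * t) /\
     0 < a t * (p0' + p1' * t) + b t * (q0' + q1' * t).
Proof.
move=> ca cb ab1 det par.
pose g t := a t * (p0 + p1 * t) + b t * (q0 + q1 * t).
have cg : {in `]- eps, eps[, continuous g}.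
  have caff (u v t : R) := derivative_continuous (derivative_affine t u v).
  move=> t te; exact: (continuous_add_at
    (continuous_mul_at (ca t te) (caff p0 p1 t))
    (continuous_mul_at (cb t te) (caff q0 q1 t))).
have g0 t : t \in `]- eps, eps[ -> g t != 0.
  move=> te; apply/negP => /eqP gt0; move/negP: det; apply; apply/eqP.
  have P0 : p0 + p1 * t = 0.
    transitivity ((p0 + p1 * t) * (a t ^+ 2 + b t ^+ 2)).
      by rewrite ab1 // mulr1.
    transitivity (a t * g t - b t * (a t * (q0 + q1 * t) - b t * (p0 + p1 * t))).
      by rewrite /g; ring.
    by rewrite gt0 par // subrr !mulr0 subr0.
  have Q0 : q0 + q1 * t = 0.
    transitivity ((q0 + q1 * t) * (a t ^+ 2 + b t ^+ 2)).
      by rewrite ab1 // mulr1.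
    transitivity (b t * g t + a t * (a t * (q0 + q1 * t) - b t * (p0 + p1 * t))).
      by rewrite /g; ring.
    by rewrite gt0 par // subrr !mulr0 addr0.
  transitivity ((p0 + p1 * t) * q1 - p1 * (q0 + q1 * t)); first by ring.
  by rewrite P0 Q0 mul0r mulr0 subr0.
have [s|s] := constant_sign cg g0.
  by exists p0, p1, q0, q1; split=> // t te; split; [exact: par|exact: s].
exists (- p0), (- p1), (- q0), (- q1); split; first by rewrite !mulrNN.
move=> t te; have := s t te; have := par t te; rewrite /g !mulNr => E F.
by split; lra.
Qed.

(** * Parameters of the acceleration *)

(** The half-open range of [theta] contains one direction of every line, and
    [eta] chooses between the two unit vectors of the line. *)
Lemma direction_angle (R : realType) (u1 u2 : R) : u1 ^+ 2 + u2 ^+ 2 = 1 ->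
  exists theta eta : R, [/\ theta \in angle_range R, eta = 1 \/ eta = -1,
    u1 = - (eta * sin theta) & u2 = eta * cos theta].
Proof.
move=> u12.
have half (v1 v2 : R) : v1 ^+ 2 + v2 ^+ 2 = 1 -> 0 < v2 ->
    exists2 theta, theta \in angle_range R & v1 = - sin theta /\ v2 = cos theta.
  move=> v12 v20; have v1_lt : `|v1| < 1.
    rewrite -(@expr_lt1 _ 2) // real_normK ?num_real //.
    by have := exprn_gt0 2 v20; lra.
  move: v1_lt; rewrite ltr_norml => /andP[v1m v1p].
  exists (asin (- v1)).
    rewrite in_itv /= asin_gtNpi2 ?asin_lepi2 //; apply/andP; split; lra.
  have rng : -1 <= - v1 <= 1 by apply/andP; split; lra.
  rewrite asinK ?in_itv //= opprK cos_asin // sqrrN; split=> //.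
  by rewrite -v12 addrAC subrr add0r sqrtr_sqr gtr0_norm.
have [u20|u20|u20] := ltgtP u2 0.
- have [||theta rng [E1 E2]] := half (- u1) (- u2); rewrite ?sqrrN ?oppr_gt0 //.
  exists theta, (-1); split=> //; first by right.
    by rewrite mulN1r opprK -[u1]opprK E1 opprK.
  by rewrite mulN1r -E2 opprK.
- have [theta rng [E1 E2]] := half u1 u2 u12 u20.
  by exists theta, 1; rewrite !mul1r; split=> //; left.
- exists (pi / 2), (- u1); rewrite sin_pihalf cos_pihalf u20 mulr0 mulr1 opprK.
  split=> //.
    by rewrite in_itv /= lexx andbT; have := @pi_gt0 R; lra.
  move: u12; rewrite u20 expr0n addr0 => /eqP; rewrite sqrf_eq1.
  by move=> /orP[]/eqP->; [right|left; rewrite opprK].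
Qed.

Lemma one_plus_sqr_gt0 (R : realType) (s : R) : 0 < 1 + s ^+ 2.
Proof. by have := sqr_ge0 s; lra. Qed.

Lemma unit_parallel (R : realType) (a b p q : R) :
  a ^+ 2 + b ^+ 2 = 1 -> a * q = b * p -> 0 < a * p + b * q ->
  a = p / Num.sqrt (p ^+ 2 + q ^+ 2) /\ b = q / Num.sqrt (p ^+ 2 + q ^+ 2).
Proof.
move=> ab par pos; set m := a * p + b * q.
have mE : p ^+ 2 + q ^+ 2 = m ^+ 2.
  transitivity (m ^+ 2 + (a * q - b * p) ^+ 2); last first.
    by rewrite par subrr expr0n addr0.
  by rewrite -[LHS]mul1r -ab /m; ring.
have m0 : m != 0 by rewrite gt_eqF.
rewrite mE sqrtr_sqr gtr0_norm //; split; apply: (mulIf m0); rewrite divfK //.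
  transitivity (p * (a ^+ 2 + b ^+ 2) + b * (a * q - b * p)); first by rewrite /m; ring.
  by rewrite ab par subrr mulr0 addr0 mulr1.
transitivity (q * (a ^+ 2 + b ^+ 2) - a * (a * q - b * p)); first by rewrite /m; ring.
by rewrite ab par subrr mulr0 subr0 mulr1.
Qed.

(** One coordinate of the acceleration: [A] and [B] are the coordinates, in the
    direction considered, of the two axes of the frame. *)
Definition profile_acceleration (R : realType) (alpha t0 A B t : R) : R :=
  (A + B * (alpha * (t - t0))) / Num.sqrt (1 + (alpha * (t - t0)) ^+ 2).

(** The costate moves along a line of direction [eta (- sin theta, cos theta)] at
    speed [n] and distance [m] from the origin, on the side given by [sigma]; it
    is closest to the origin at [t0].  Dividing by [m] gives
    [sigma (cos theta, sin theta) + eta s (- sin theta, cos theta)] with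
    [s = (n / m) (t - t0)]. *)
Lemma costate_parameters (R : realType) (eps p0 p1 q0 q1 : R) (a b : R -> R) :
  (forall t, t \in `]- eps, eps[ -> a t ^+ 2 + b t ^+ 2 = 1) ->
  p0 * q1 - p1 * q0 != 0 ->
  (forall t, t \in `]- eps, eps[ ->
     a t * (q0 + q1 * t) = b t * (p0 + p1 * t) /\
     0 < a t * (p0 + p1 * t) + b t * (q0 + q1 * t)) ->
  exists alpha theta sigma eta t0 : R,
    [/\ 0 < alpha, theta \in angle_range R,
        sigma = 1 \/ sigma = -1, eta = 1 \/ eta = -1 &
        forall t, t \in `]- eps, eps[ ->
        a t = profile_acceleration alpha t0 (cos theta * sigma) (- (sin theta * eta)) t /\
        b t = profile_acceleration alpha t0 (sin theta * sigma) (cos theta * eta) t].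
Proof.
move=> ab1 det par.
pose n := Num.sqrt (p1 ^+ 2 + q1 ^+ 2).
have n2 : n ^+ 2 = p1 ^+ 2 + q1 ^+ 2 by rewrite sqr_sqrtr // addr_ge0 ?sqr_ge0.
have n0 : 0 < n.
  rewrite lt_def sqrtr_ge0 andbT -sqrf_eq0 n2 paddr_eq0 ?sqr_ge0 // !sqrf_eq0.
  apply: contra det => /andP[/eqP-> /eqP->].
  by rewrite mulr0 mul0r subrr.
have nn0 : n != 0 by rewrite gt_eqF.
have [|theta [eta [rng eta1 p1E q1E]]] := @direction_angle _ (p1 / n) (q1 / n).
  by rewrite !expr_div_n -mulrDl n2 divff // -n2 sqrf_eq0.
have {}p1E : p1 = - (n * (eta * sin theta)).
  by rewrite -mulrN -p1E mulrC divfK.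
have {}q1E : q1 = n * (eta * cos theta) by rewrite -q1E mulrC divfK.
have cs := cos2Dsin2 theta.
have eta2 : eta * eta = 1 by case: eta1 => ->; rewrite ?mulrNN mulr1.
pose d := p0 * cos theta + q0 * sin theta.
have d0 : d != 0.
  apply: contra det => /eqP dz; rewrite p1E q1E.
  rewrite (_ : _ - _ = n * eta * d); last by rewrite /d; ring.
  by rewrite dz mulr0.
pose sigma : R := if 0 < d then 1 else -1.
have sigma1 : sigma = 1 \/ sigma = -1 by rewrite /sigma; case: ifP; [left|right].
pose m := `|d|.
have m0 : 0 < m by rewrite normr_gt0.
have dE : d = m * sigma.
  rewrite /m /sigma; have [dd|dd|dd] := ltgtP 0 d.
  - by rewrite gtr0_norm // mulr1.
  - by rewrite ltr0_norm // mulrN1 opprK.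
  - by rewrite -dd normr0 mul0r.
pose t0 := - (eta * (q0 * cos theta - p0 * sin theta)) / n.
exists (n / m), theta, sigma, eta, t0; split=> //; first by rewrite divr_gt0.
move=> t te; have [E pos] := par t te; have ab := ab1 t te.
pose s := n / m * (t - t0).
have msE : m * s = n * t + eta * (q0 * cos theta - p0 * sin theta).
  by rewrite /s /t0; field; rewrite nn0 gt_eqF.
have PE : p0 + p1 * t = m * (cos theta * sigma + - (sin theta * eta) * s).
  transitivity (cos theta * (m * sigma) - sin theta * eta * (m * s)); last by ring.
  rewrite -dE msE p1E /d -[p0 in LHS]mulr1 -cs.
  transitivity (p0 * (cos theta ^+ 2 + sin theta ^+ 2 * (eta * eta)) +
   q0 * cos theta * sin theta * (1 - eta * eta) - n * (eta * sin theta) * t).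
    by rewrite eta2 mulr1 subrr mulr0 addr0 mulNr.
  by ring.
have QE : q0 + q1 * t = m * (sin theta * sigma + cos theta * eta * s).
  transitivity (sin theta * (m * sigma) + cos theta * eta * (m * s)); last by ring.
  rewrite -dE msE q1E /d -[q0 in LHS]mulr1 -cs.
  transitivity (q0 * (cos theta ^+ 2 * (eta * eta) + sin theta ^+ 2) +
   p0 * cos theta * sin theta * (1 - eta * eta) + n * (eta * cos theta) * t).
    by rewrite eta2 mulr1 subrr mulr0 addr0.
  by ring.
move: E pos; rewrite PE QE => E pos.
rewrite /profile_acceleration -/s.
have -> : 1 + s ^+ 2 = (cos theta * sigma + - (sin theta * eta) * s) ^+ 2 +
    (sin theta * sigma + cos theta * eta * s) ^+ 2.
  transitivity ((cos theta ^+ 2 + sin theta ^+ 2) *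
      (sigma ^+ 2 + eta ^+ 2 * s ^+ 2)); last by ring.
  by rewrite cs mul1r; case: sigma1 => ->; case: eta1 => ->; ring.
apply: unit_parallel => //.
  by apply: (mulfI (lt0r_neq0 m0)); rewrite mulrCA E mulrCA.
by rewrite -(pmulr_rgt0 _ m0) mulrDr mulrCA [m * (b t * _)]mulrCA.
Qed.

Lemma quadratic_eq0 (R : realType) (eps k0 k1 k2 : R) : 0 < eps ->
  (forall t, t \in `]- eps, eps[ -> k0 + k1 * t + k2 * t ^+ 2 = 0) ->
  [/\ k0 = 0, k1 = 0 & k2 = 0].
Proof.
move=> eps0 k; pose h := eps / 2.
have h0 : h != 0 by rewrite gt_eqF // /h; lra.
have k00 : k0 = 0.
  by have := k 0; rewrite mulr0 expr0n mulr0 !addr0; apply; rewrite in_itv /=; lra.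
have kp : k0 + k1 * h + k2 * h ^+ 2 = 0.
  by apply: k; rewrite in_itv /= /h; apply/andP; split; lra.
have km : k0 + k1 * - h + k2 * (- h) ^+ 2 = 0.
  by apply: k; rewrite in_itv /= /h; apply/andP; split; lra.
rewrite sqrrN in km; split=> //; apply: (mulIf h0); rewrite mul0r.
  lra.
apply: (mulIf h0); rewrite mul0r -mulrA -expr2; lra.
Qed.

Lemma angle_eq (R : realType) (theta theta' : R) :
  theta \in angle_range R -> theta' \in angle_range R ->
  sin (theta' - theta) = 0 -> theta = theta'.
Proof.
rewrite !in_itv /= => /andP[l u] /andP[l' u'] s0.
have [lt|lt|//] := ltgtP theta theta'.
  have := @sin_gt0_pi _ (theta' - theta); rewrite s0 ltxx => H.
  by have : false by apply: H; apply/andP; split; lra.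
have := @sin_gt0_pi _ (theta - theta'); rewrite -opprB sinN s0 oppr0 ltxx => H.
by have : false by apply: H; apply/andP; split; lra.
Qed.

Lemma scaled_signs (R : realType) (al al' si si' et et' : R) :
  0 < al -> 0 < al' -> si = 1 \/ si = -1 -> si' = 1 \/ si' = -1 ->
  et = 1 \/ et = -1 -> et' = 1 \/ et' = -1 ->
  si * et' * al' = si' * et * al -> al = al' /\ si * et' = si' * et.
Proof.
by move=> al0 al0' [] -> [] -> [] -> [] -> E; split; lra.
Qed.

Lemma signs_eq (R : realType) (q si si' et et' : R) :
  0 <= q -> si = 1 \/ si = -1 -> si' = 1 \/ si' = -1 ->
  et = 1 \/ et = -1 -> et' = 1 \/ et' = -1 ->
  si * et' = si' * et -> 0 < si * si' + et * et' * q -> si = si' /\ et = et'.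
Proof.
by move=> q0 [] -> [] -> [] -> [] -> E p; split; lra.
Qed.

(** Equal accelerations make the two affine functions [(X, Y)] and [(X', Y')]
    parallel with positive scalar product.  Their cross product is a quadratic
    polynomial in [t]: its leading coefficient gives the angle; once the angles
    agree, the lower ones give [alpha] and [t0], and leave a common change of
    both signs that only the scalar product excludes. *)
Lemma profile_acceleration_inj (R : realType) (eps : R)
    (al th si et t0 al' th' si' et' t0' : R) :
  0 < eps ->
  0 < al -> th \in angle_range R -> si = 1 \/ si = -1 -> et = 1 \/ et = -1 ->
  0 < al' -> th' \in angle_range R -> si' = 1 \/ si' = -1 -> et' = 1 \/ et' = -1 ->
  (forall t, t \in `]- eps, eps[ ->
     profile_acceleration al t0 (cos th * si) (- (sin th * et)) t =
     profile_acceleration al' t0' (cos th' * si') (- (sin th' * et')) t /\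
     profile_acceleration al t0 (sin th * si) (cos th * et) t =
     profile_acceleration al' t0' (sin th' * si') (cos th' * et') t) ->
  (al, th, si, et, t0) = (al', th', si', et', t0').
Proof.
move=> eps0 al0 rng si1 et1 al0' rng' si1' et1' E.
pose z t := al * (t - t0); pose z' t := al' * (t - t0').
have cs := cos2Dsin2 th; have cs' := cos2Dsin2 th'.
have et0 : et != 0 by case: et1 => ->; rewrite ?oppr_eq0 oner_eq0.
have et0' : et' != 0 by case: et1' => ->; rewrite ?oppr_eq0 oner_eq0.
have sq (k : R) : k = 1 \/ k = -1 -> k ^+ 2 = 1.
  by case=> ->; rewrite ?sqrrN expr1n.
pose X t := cos th * si + - (sin th * et) * z t.
pose Y t := sin th * si + cos th * et * z t.
pose X' t := cos th' * si' + - (sin th' * et') * z' t.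
pose Y' t := sin th' * si' + cos th' * et' * z' t.
have cross_dot t : t \in `]- eps, eps[ ->
    X t * Y' t - Y t * X' t = 0 /\ 0 < X t * X' t + Y t * Y' t.
  move=> te; have [] := E t te; rewrite /profile_acceleration -/(z t) -/(z' t).
  rewrite -/(X t) -/(Y t) -/(X' t) -/(Y' t).
  set w := Num.sqrt (1 + z t ^+ 2); set w' := Num.sqrt (1 + z' t ^+ 2) => EX EY.
  have w0 : 0 < w by rewrite sqrtr_gt0 one_plus_sqr_gt0.
  have w0' : 0 < w' by rewrite sqrtr_gt0 one_plus_sqr_gt0.
  have X'E : X' t = w' * (X t / w) by rewrite EX mulrC divfK // gt_eqF.
  have Y'E : Y' t = w' * (Y t / w) by rewrite EY mulrC divfK // gt_eqF.
  split; first by rewrite X'E Y'E; ring.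
  rewrite X'E Y'E; have -> : X t * (w' * (X t / w)) + Y t * (w' * (Y t / w)) =
    w' / w * ((cos th ^+ 2 + sin th ^+ 2) * (si ^+ 2 + et ^+ 2 * z t ^+ 2)).
    by rewrite /X /Y; ring.
  rewrite cs mul1r (sq si si1) (sq et et1) mul1r mulr_gt0 ?divr_gt0 //.
  exact: one_plus_sqr_gt0.
have thE : th = th'.
  apply: angle_eq => //; rewrite sinB.
  have [|_ _ k2] := @quadratic_eq0 _ eps
    ((cos th * si + sin th * et * al * t0) * (sin th' * si' - cos th' * et' * al' * t0') -
     (sin th * si - cos th * et * al * t0) * (cos th' * si' + sin th' * et' * al' * t0'))
    ((cos th * si + sin th * et * al * t0) * (cos th' * et' * al') -
     (sin th * et * al) * (sin th' * si' - cos th' * et' * al' * t0') +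
     (sin th * si - cos th * et * al * t0) * (sin th' * et' * al') -
     (cos th * et * al) * (cos th' * si' + sin th' * et' * al' * t0'))
    (al * al' * et * et' * (sin th' * cos th - cos th' * sin th)) eps0.
    move=> t /cross_dot[<- _]; rewrite /X /Y /X' /Y' /z /z'; ring.
  move/eqP: k2; rewrite !mulf_eq0 (negPf et0) (negPf et0') (gt_eqF al0) (gt_eqF al0') /=.
  by move=> /eqP.
subst th'.
have crossE t : X t * Y' t - Y t * X' t = si * et' * z' t - si' * et * z t.
  transitivity ((cos th ^+ 2 + sin th ^+ 2) * (si * et' * z' t - si' * et * z t)).
    by rewrite /X /Y /X' /Y'; ring.
  by rewrite cs mul1r.
have dotE t : X t * X' t + Y t * Y' t = si * si' + et * et' * (z t * z' t).
  transitivity ((cos th ^+ 2 + sin th ^+ 2) * (si * si' + et * et' * (z t * z' t))).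
    by rewrite /X /Y /X' /Y'; ring.
  by rewrite cs mul1r.
have [|k0 k1 _] := @quadratic_eq0 _ eps (si' * et * al * t0 - si * et' * al' * t0')
   (si * et' * al' - si' * et * al) 0 eps0.
  by move=> t /cross_dot[C _]; rewrite -[RHS]C crossE /z /z'; ring.
have [] := scaled_signs al0 al0' si1 si1' et1 et1' (subr0_eq k1).
move=> alE sE; subst al'.
have t0E : t0 = t0'.
  have : si' * et * al * (t0 - t0') = 0 by rewrite -k0 sE; ring.
  move/eqP; rewrite !mulf_eq0 (negPf et0) (gt_eqF al0) !orbF subr_eq0.
  by case: si1' => ->; rewrite ?oppr_eq0 oner_eq0 => /eqP.
subst t0'.
have [|_] := cross_dot 0; first by rewrite in_itv /=; lra.
rewrite dotE /z' -/(z 0) -expr2 => dot.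
by have [-> ->] := signs_eq (sqr_ge0 (z 0)) si1 si1' et1 et1' sE dot.
Qed.

(** * The two profiles and the paths built from them *)

Lemma derivative_sqrt1p (R : realType) (t : R) :
  has_derivative (fun s : R => Num.sqrt (1 + s ^+ 2)) t (t / Num.sqrt (1 + t ^+ 2)).
Proof.
have t1 := one_plus_sqr_gt0 t.
apply: derivative_eq.
  apply: (@derivative_comp _ Num.sqrt (fun s => 1 + s ^+ 2)).
    exact: (is_derive1_sqrt t1).
  apply: derivative_add; first exact: derivative_cst.
  apply: (@derivative_mul _ (fun s => s) (fun s => s)); exact: derivative_id.
have : Num.sqrt (1 + t ^+ 2) != 0 by rewrite gt_eqF // sqrtr_gt0.
by move=> ?; field.
Qed.

Lemma derivative_arcsinh (R : realType) (t : R) :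
  has_derivative (@arcsinh R) t (Num.sqrt (1 + t ^+ 2))^-1.
Proof.
have w0 : 0 < Num.sqrt (1 + t ^+ 2) by rewrite sqrtr_gt0 one_plus_sqr_gt0.
have pos : 0 < t + Num.sqrt (1 + t ^+ 2).
  have : `|t| < Num.sqrt (1 + t ^+ 2).
    by rewrite -sqrtr_sqr ltr_sqrt ?one_plus_sqr_gt0 // ltrDr.
  by rewrite ltr_norml => /andP[]; lra.
apply: derivative_eq.
  apply: (@derivative_comp _ (@ln R) (fun s => s + Num.sqrt (1 + s ^+ 2))).
    exact: (is_derive1_ln pos).
  by apply: derivative_add; [exact: derivative_id|exact: derivative_sqrt1p].
by field; rewrite !gt_eqF.
Qed.

Lemma derivative_profile_f (R : realType) (t : R) :
  has_derivative (@profile_f R) t (arcsinh t).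
Proof.
have w0 : Num.sqrt (1 + t ^+ 2) != 0 by rewrite gt_eqF // sqrtr_gt0 one_plus_sqr_gt0.
apply: derivative_eq.
  apply: (@derivative_add _ (fun s => s * arcsinh s) (fun s => - Num.sqrt (1 + s ^+ 2))).
    by apply: derivative_mul; [exact: derivative_id|exact: derivative_arcsinh].
  under eq_fun do rewrite -mulN1r.
  by apply: derivative_scale; exact: derivative_sqrt1p.
by rewrite /=; field.
Qed.

Lemma derivative_profile_g (R : realType) (t : R) :
  has_derivative (@profile_g R) t (Num.sqrt (1 + t ^+ 2)).
Proof.
have w0 : 0 < Num.sqrt (1 + t ^+ 2) by rewrite sqrtr_gt0 one_plus_sqr_gt0.
have wn : Num.sqrt (1 + t ^+ 2) != 0 by rewrite gt_eqF.
have w2 : Num.sqrt (1 + t ^+ 2) ^+ 2 = 1 + t ^+ 2.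
  by rewrite sqr_sqrtr // ltW // one_plus_sqr_gt0.
apply: derivative_eq.
  apply: derivative_scale; apply: derivative_add; last exact: derivative_arcsinh.
  by apply: derivative_mul; [exact: derivative_id|exact: derivative_sqrt1p].
apply: (mulIf wn) => /=.
rewrite -expr2 w2 mulr1; move: w2; set w := Num.sqrt _ in wn *; move=> w2.
transitivity (2^-1 * (w ^+ 2 + t ^+ 2 + 1)); first by field.
by rewrite w2; field.
Qed.

(** One coordinate of the paths being classified: [A] and [B] are the entries of
    the matrix row that produces it. *)
Definition profile_path (R : realType) (alpha t0 A B u v t : R) : R :=
  (alpha ^+ 2)^-1 *
  (A * (profile_f (alpha * (t - t0)) + u * (alpha * (t - t0))) +
   B * (profile_g (alpha * (t - t0)) + v * (alpha * (t - t0)))).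

Definition profile_velocity (R : realType) (alpha t0 A B u v t : R) : R :=
  alpha^-1 *
  (A * (arcsinh (alpha * (t - t0)) + u) +
   B * (Num.sqrt (1 + (alpha * (t - t0)) ^+ 2) + v)).

Lemma derivative_shift_scale (R : realType) (F : R -> R) (alpha t0 t f : R) :
  has_derivative F (alpha * (t - t0)) f ->
  has_derivative (fun s => F (alpha * (s - t0))) t (f * alpha).
Proof.
move=> dF; apply: derivative_comp => //.
apply: derivative_eq; first apply: derivative_scale.
  by apply: derivative_add; [exact: derivative_id|exact: derivative_cst].
by rewrite addr0 mulr1.
Qed.

Lemma derivative_profile_path (R : realType) (alpha t0 A B u v t : R) :
  alpha != 0 ->
  has_derivative (profile_path alpha t0 A B u v) t
    (profile_velocity alpha t0 A B u v t).
Proof.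
move=> al0; apply: derivative_eq.
  apply: derivative_scale; apply: derivative_add; apply: derivative_scale;
    apply: derivative_add.
  - by apply: derivative_shift_scale; exact: derivative_profile_f.
  - apply: derivative_scale; apply: (@derivative_shift_scale _ (fun s => s)).
    exact: derivative_id.
  - by apply: derivative_shift_scale; exact: derivative_profile_g.
  - apply: derivative_scale; apply: (@derivative_shift_scale _ (fun s => s)).
    exact: derivative_id.
by rewrite /profile_velocity; field.
Qed.

Lemma derivative_profile_velocity (R : realType) (alpha t0 A B u v t : R) :
  alpha != 0 ->
  has_derivative (profile_velocity alpha t0 A B u v) t
    (profile_acceleration alpha t0 A B t).
Proof.
move=> al0; apply: derivative_eq.
  apply: derivative_scale; apply: derivative_add; apply: derivative_scale;
    apply: derivative_add; try exact: derivative_cst.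
  - by apply: derivative_shift_scale; exact: derivative_arcsinh.
  - apply: (@derivative_shift_scale _ (fun s => Num.sqrt (1 + s ^+ 2))).
    exact: derivative_sqrt1p.
rewrite /profile_acceleration.
have : Num.sqrt (1 + (alpha * (t - t0)) ^+ 2) != 0.
  by rewrite gt_eqF // sqrtr_gt0 one_plus_sqr_gt0.
by move=> w0; field; rewrite ?w0 ?al0.
Qed.

Lemma derivative0_constant (R : realType) (eps : R) (F : R -> R) :
  0 < eps ->
  (forall t, t \in `]- eps, eps[ -> has_derivative F t 0) ->
  forall t, t \in `]- eps, eps[ -> F t = F 0.
Proof.
move=> eps0 dF t te.
have sub s z w : z \in `]- eps, eps[ -> w \in `]- eps, eps[ -> s \in `[z, w] ->
    s \in `]- eps, eps[.
  rewrite !in_itv /= => /andP[z1 z2] /andP[w1 w2] /andP[s1 s2].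
  by apply/andP; split; lra.
have zero_in : 0 \in `]- eps, eps[ by rewrite in_itv /=; lra.
have step z w : z \in `]- eps, eps[ -> w \in `]- eps, eps[ -> z <= w -> F w = F z.
  move=> ze we zw; apply/eqP; rewrite -subr_eq0.
  rewrite (@eq_increment _ F (fun=> 0) (fun=> 0) z w zw) ?subrr //.
    by move=> s szw; apply: dF; exact: sub szw.
  by move=> s _; exact: derivative_cst.
by have [t0|/ltW t0] := leP 0 t; [exact: step|rewrite (step t 0)].
Qed.

Lemma integrate_twice (R : realType) (eps t0 : R) (X U Y V w : R -> R) :
  0 < eps ->
  (forall t, t \in `]- eps, eps[ ->
     has_derivative X t (U t) /\ has_derivative U t (w t)) ->
  (forall t, t \in `]- eps, eps[ ->
     has_derivative Y t (V t) /\ has_derivative V t (w t)) ->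
  exists c k : R, forall t, t \in `]- eps, eps[ -> X t = c + k * (t - t0) + Y t.
Proof.
move=> eps0 dX dY.
pose k := U 0 + -1 * V 0.
have kE t : t \in `]- eps, eps[ -> U t + -1 * V t = k.
  move=> te; apply: (@derivative0_constant _ _ (fun s => U s + -1 * V s) eps0) => // s se.
  apply: derivative_eq; first apply: derivative_add.
  - exact: (dX s se).2.
  - by apply: derivative_scale; exact: (dY s se).2.
  - by rewrite mulN1r subrr.
pose D s := X s + -1 * Y s + (0 + - k * s).
exists (D 0 + k * t0), k => t te.
have : D t = D 0; last by rewrite /D; lra.
apply: (@derivative0_constant _ _ D eps0) => // s se.
apply: derivative_eq; first apply: derivative_add; last 2 first.
- exact: derivative_affine.
- rewrite -(kE s se); exact: subrr.
- apply: derivative_add; first exact: (dX s se).1.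
  by apply: derivative_scale; exact: (dY s se).1.
Qed.

Lemma second_derivative_local (R : realType) (eps : R) (x F F1 F2 : R -> R) :
  (forall t, t \in `]- eps, eps[ -> x t = F t) ->
  (forall t, has_derivative F t (F1 t)) ->
  (forall t, has_derivative F1 t (F2 t)) ->
  forall t, t \in `]- eps, eps[ -> derive1n 2 x t = F2 t.
Proof.
move=> xF dF dF1.
have loc (f g h : R -> R) : (forall t, t \in `]- eps, eps[ -> f t = g t) ->
    (forall t, has_derivative g t (h t)) ->
    forall t, t \in `]- eps, eps[ -> derive1 f t = h t.
  move=> fg dg t te; have [_ <-] := dg t; rewrite derive1E; apply: near_eq_derive.
  by near=> z; apply: fg; near: z; exact: near_in_itvoo.
by apply: (loc _ F1 F2) => //; exact: (loc _ F F1).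
Unshelve. all: by end_near. Qed.

Lemma vec2_profile (R : realType) (x y alpha theta sigma eta F G : R) (c : 'cV[R]_2) :
  vec2 x y = c + alpha *: (mx2 (cos theta) (- sin theta) (sin theta) (cos theta)
     *m mx2 sigma 0 0 eta *m vec2 F G) <->
  x = c 0 0 + alpha * (cos theta * sigma * F + - (sin theta * eta) * G) /\
  y = c 1 0 + alpha * (sin theta * sigma * F + cos theta * eta * G).
Proof.
split.
  move=> E; split.
    move: (congr1 (fun m : 'cV_2 => m 0 0) E); rewrite !mxE /=.
    rewrite !big_ord_recl big_ord0 !mxE /= !big_ord_recl !big_ord0 !mxE /= => ->.
    by congr (_ + _); ring.
  move: (congr1 (fun m : 'cV_2 => m 1 0) E); rewrite !mxE /=.
  rewrite !big_ord_recl big_ord0 !mxE /= !big_ord_recl !big_ord0 !mxE /= => ->.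
  by congr (_ + _); ring.
move=> [-> ->]; apply/colP => i; rewrite !mxE /=.
rewrite !big_ord_recl big_ord0 !mxE /= !big_ord_recl !big_ord0 !mxE /=.
case: i => -[|[|//]] i2 /=.
  by rewrite (_ : Ordinal i2 = 0); [congr (_ + _); ring|exact: val_inj].
by rewrite (_ : Ordinal i2 = 1); [congr (_ + _); ring|exact: val_inj].
Qed.

(** * The classification *)

Theorem proposition2p1 (R : realType) (eps : R) (x y : R -> R)
  (heps : 0 < eps)
  (hmin : minimal_time_path eps x y)
  (hvel : forall t : R, t \in `]- eps, eps[ -> derivable x t 1 /\ derivable y t 1)
  (hacc : forall t : R, t \in `]- eps, eps[ ->
            derivable (derive1 x) t 1 /\ derivable (derive1 y) t 1)
  (hcont : {in `]- eps, eps[, continuous (derive1n 2 x)} /\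
           {in `]- eps, eps[, continuous (derive1n 2 y)})
  (hunit : forall t : R, t \in `]- eps, eps[ ->
             enorm (derive1n 2 x t) (derive1n 2 y t) = 1)
  (hnonconst : ~ exists k : R * R, forall t : R, t \in `]- eps, eps[ ->
                 (derive1n 2 x t, derive1n 2 y t) = k) :
  exists! p : R * R * R * R * R,
    let: (alpha, theta, sigma, eta, t0) := p in
    [/\ 0 < alpha, theta \in angle_range R,
        sigma = 1 \/ sigma = -1, eta = 1 \/ eta = -1
      & exists (u0 v0 : R) (c : 'cV[R]_2), forall t : R, t \in `]- eps, eps[ ->
          vec2 (x t) (y t) =
          c + (alpha ^+ 2)^-1 *:
            (mx2 (cos theta) (- sin theta) (sin theta) (cos theta)
             *m mx2 sigma 0 0 eta
             *m vec2 (profile_f (alpha * (t - t0)) + u0 * (alpha * (t - t0)))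
                     (profile_g (alpha * (t - t0)) + v0 * (alpha * (t - t0))))].
Proof.
pose a := derive1n 2 x; pose b := derive1n 2 y.
have [ca cb] : {in `]- eps, eps[, continuous a} /\
    {in `]- eps, eps[, continuous b} := hcont.
have ab1 t : t \in `]- eps, eps[ -> a t ^+ 2 + b t ^+ 2 = 1.
  move=> /hunit E; have <- : enorm (a t) (b t) ^+ 2 = 1 by rewrite E expr1n.
  by rewrite sqr_sqrtr // addr_ge0 ?sqr_ge0.
have hd (f : R -> R) t : derivable f t 1 -> has_derivative f t (derive1 f t).
  by move=> df; apply: DeriveDef => //; rewrite derive1E.
have dx t : t \in `]- eps, eps[ ->
    has_derivative x t (derive1 x t) /\ has_derivative (derive1 x) t (a t).
  by move=> te; split; apply: hd; [exact: (hvel t te).1|exact: (hacc t te).1].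
have dy t : t \in `]- eps, eps[ ->
    has_derivative y t (derive1 y t) /\ has_derivative (derive1 y) t (b t).
  by move=> te; split; apply: hd; [exact: (hvel t te).2|exact: (hacc t te).2].
have accel al th si et t0 : 0 < al ->
    (exists (u0 v0 : R) (c : 'cV[R]_2), forall t : R, t \in `]- eps, eps[ ->
      vec2 (x t) (y t) = c + (al ^+ 2)^-1 *:
        (mx2 (cos th) (- sin th) (sin th) (cos th) *m mx2 si 0 0 et
         *m vec2 (profile_f (al * (t - t0)) + u0 * (al * (t - t0)))
                 (profile_g (al * (t - t0)) + v0 * (al * (t - t0))))) ->
    forall t, t \in `]- eps, eps[ ->
      a t = profile_acceleration al t0 (cos th * si) (- (sin th * et)) t /\
      b t = profile_acceleration al t0 (sin th * si) (cos th * et) t.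
  move=> al0 [u0 [v0 [c E]]] t te; have aln : al != 0 by rewrite gt_eqF.
  have loc (z : R -> R) A B k :
      (forall s, s \in `]- eps, eps[ -> z s = k + profile_path al t0 A B u0 v0 s) ->
      derive1n 2 z t = profile_acceleration al t0 A B t.
    move=> zE; apply: (second_derivative_local zE _ _ te) => s.
      apply: derivative_eq; last exact: add0r.
      apply: derivative_add; first exact: derivative_cst.
      exact: derivative_profile_path.
    exact: derivative_profile_velocity.
  split; [apply: (loc _ _ _ (c 0 0))|apply: (loc _ _ _ (c 1 0))] => s se.
    by have /vec2_profile[-> _] := E s se.
  by have /vec2_profile[_ ->] := E s se.
have [p0 [p1 [q0 [q1 [pq0 par]]]]] := affine_costate heps hmin ca cb ab1 dx dy.
have det := costate_nondegenerate heps ca cb ab1 hnonconst pq0 par.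
have [p0' [p1' [q0' [q1' [det' par']]]]] := costate_orientation ca cb ab1 det par.
have [al [th [si [et [t0 [al0 rng si1 et1 abE]]]]]] :=
  costate_parameters ab1 det' par'.
exists (al, th, si, et, t0); split; last first.
  move=> [[[[al' th'] si'] et'] t0'] [al0' rng' si1' et1' /(accel _ _ _ _ _ al0') abE'].
  apply: (profile_acceleration_inj heps) => // t te.
  by have [<- <-] := abE t te; have [<- <-] := abE' t te.
have aln : al != 0 by rewrite gt_eqF.
have two (A B : R) (z w : R -> R) :
    (forall t, t \in `]- eps, eps[ ->
       has_derivative z t (derive1 z t) /\ has_derivative (derive1 z) t (w t)) ->
    (forall t, t \in `]- eps, eps[ -> w t = profile_acceleration al t0 A B t) ->
    exists c k : R, forall t, t \in `]- eps, eps[ ->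
      z t = c + k * (t - t0) + profile_path al t0 A B 0 0 t.
  move=> dz wE; apply: (integrate_twice t0 heps dz) => t te.
  split; first exact: derivative_profile_path.
  by rewrite (wE t te); exact: derivative_profile_velocity.
have [cx [kx xE]] := two _ _ _ _ dx (fun t te => (abE t te).1).
have [cy [ky yE]] := two _ _ _ _ dy (fun t te => (abE t te).2).
split=> //.
(* The drift (kx, ky) written in the frame of the two profiles. *)
exists (al * si * (cos th * kx + sin th * ky)),
  (al * et * (cos th * ky - sin th * kx)), (vec2 cx cy) => t te.
apply/vec2_profile; rewrite !mxE /= xE // yE // /profile_path.
have cs := cos2Dsin2 th.
have si2 : si ^+ 2 = 1 by case: si1 => ->; rewrite ?sqrrN expr1n.
have et2 : et ^+ 2 = 1 by case: et1 => ->; rewrite ?sqrrN expr1n.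
have kxE : kx = cos th * si ^+ 2 * (cos th * kx + sin th * ky) -
   sin th * et ^+ 2 * (cos th * ky - sin th * kx).
  by rewrite si2 et2 !mulr1 -[LHS]mul1r -cs; ring.
have kyE : ky = sin th * si ^+ 2 * (cos th * kx + sin th * ky) +
   cos th * et ^+ 2 * (cos th * ky - sin th * kx).
  by rewrite si2 et2 !mulr1 -[LHS]mul1r -cs; ring.
by split; [rewrite [in LHS]kxE|rewrite [in LHS]kyE]; field.
Qed.
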